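(* Let $n\ge 1$, let $\vec b=(b_1,\dots,b_n)\in\mathbb{R}^n\setminus\{0\}$, and let $S_{\vec b}(x)=\sum_{j=1}^n b_j h_j(x)$ be the corresponding linear combination of the first $n$ Dirichlet eigenfunctions. Then $S_{\vec b}$ has finitely many zeros in $\mathrm I=(0,1)$, each of finite order. Let $\bar c_1<\dots<\bar c_p$ denote the distinct zeros of $S_{\vec b}$ in $\mathrm I$, and let $k_j$ be the order of vanishing of $S_{\vec b}$ at $\bar c_j$, $1\le j\le p$. Then: 1. $k_1+\dots+k_p\le n-1$. 2. If $k_1+\dots+k_p=n-1$, then there exists a nonzero constant $C$ such that, for all $x\in\mathrm I$, $$S_{\vec b}(x)=C\,\left|\vec h(\bar c_1)\ \vec h^{(1)}(\bar c_1)\cdots\vec h^{(k_1-1)}(\bar c_1)\ \cdots\ \vec h(\bar c_p)\cdots\vec h^{(k_p-1)}(\bar c_p)\ \vec h(x)\right| ,$$ where the right-hand side is the determinant of the $n\times n$ matrix with the indicated columns.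
   Context: Let $q$ be a real-valued $C^\infty$ function defined in a neighborhood of $[0,1]$, and $\mathrm I=(0,1)$. Consider the Dirichlet Sturm-Liouville problem $-y''+q\,y=\lambda y$ in $(0,1)$, $y(0)=y(1)=0$. Its eigenvalues are simple, $\lambda_1<\lambda_2<\cdots\to\infty$; $\{h_j\}_{j\ge1}$ is an associated orthonormal basis of $L^2(\mathrm I)$ consisting of real eigenfunctions, $h_j$ being associated with $\lambda_j$. For $m\ge 0$, $\vec h^{(m)}(a)$ is the column vector $(h_1^{(m)}(a),\dots,h_n^{(m)}(a))$ of $m$-th derivatives at $a$, and $\vec h=\vec h^{(0)}$. The order of vanishing of a smooth function $f$ at $a$ is the least $k$ with $f^{(k)}(a)\neq0$. *)

(* Defs.v *)
From mathcomp Require Export all_boot all_order all_algebra.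
From mathcomp Require Export all_classical all_reals all_analysis.

Set Implicit Arguments.
Unset Strict Implicit.
Unset Printing Implicit Defensive.

Import Order.TTheory GRing.Theory Num.Theory.
Export numFieldNormedType.Exports.

Local Open Scope classical_set_scope.
Local Open Scope ring_scope.

Definition smooth_near_unit_interval (R : realType) (q : R -> R) : Prop :=
  exists U : set R, [/\ open U, `[0, 1]%classic `<=` U &
    forall (m : nat) (x : R), U x -> derivable (derive1n m q) x 1].

(* A classical solution, in C([0,1]) and twice differentiable on (0,1).
   Values of y outside [0,1] are irrelevant: derivatives are only taken at
   points of the open interval. *)
Definition dirichlet_eigenfunction (R : realType) (q : R -> R) (mu : R)
    (y : R -> R) : Prop :=
  [/\ {within `[0, 1], continuous y},
      forall x : R, x \in `]0, 1[ ->
        [/\ derivable y x 1, derivable (derive1 y) x 1 &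
            - derive1n 2 y x + q x * y x = mu * y x],
      y 0 = 0, y 1 = 0 & exists2 x : R, x \in `]0, 1[ & y x != 0].

Definition dirichlet_eigenvalue (R : realType) (q : R -> R) (mu : R) : Prop :=
  exists y : R -> R, dirichlet_eigenfunction q mu y.

Section L2.
Variable R : realType.
Let I : set R := `]0, 1[%classic.

(* [f \_ I] is f on I extended by 0, so its norm over the line is the norm of
   f over I. *)
Definition L2_unit (f : R -> R) : Prop :=
  f \_ I \in Lfun (@lebesgue_measure R) 2%:E.

Definition L2_norm (f : R -> R) : \bar R :=
  ('N[@lebesgue_measure R]_2%:E [EFin \o (f \_ I)])%E.

Definition L2_dot (f g : R -> R) : R :=
  \int[@lebesgue_measure R]_(x in I) (f x * g x).

Definition L2_orthonormal_basis (h : nat -> R -> R) : Prop :=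
  [/\ forall j, L2_unit (h j),
      forall i j, L2_dot (h i) (h j) = (i == j)%:R &
      forall f, L2_unit f ->
        L2_norm (fun x => f x - \sum_(j < N) L2_dot f (h j) * h j x)
          @[N --> \oo] --> 0%E].

End L2.

(* Indices start at 0: lambda j and h j are the eigenvalue and eigenfunction
   number j + 1. *)
Record dirichlet_eigenbasis (R : realType) (q : R -> R) (lambda : nat -> R)
    (h : nat -> R -> R) : Prop := DirichletEigenbasis {
  eigenvalue_increasing : forall i j, (i < j)%N -> lambda i < lambda j;
  eigenvalue_enum : forall mu,
    dirichlet_eigenvalue q mu <-> exists j, mu = lambda j;
  eigenbasis_eigenfunction : forall j,
    dirichlet_eigenfunction q (lambda j) (h j);
  eigenbasis_orthonormal_basis : L2_orthonormal_basis h }.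

Definition vanishing_order (R : realType) (f : R -> R) (a : R) (k : nat) :
    Prop :=
  derive1n k f a != 0 /\ forall i, (i < k)%N -> derive1n i f a = 0.

Definition linear_comb (R : realType) (n : nat) (h : nat -> R -> R)
    (b : 'cV[R]_n) : R -> R :=
  fun x => \sum_(j < n) b j 0 * h j x.

Definition hvec (R : realType) (n : nat) (h : nat -> R -> R) (m : nat)
    (a : R) : 'cV[R]_n :=
  \col_(i < n) derive1n m (h i) a.

(* The columns h(c_j), h^(1)(c_j), ..., h^(k_j - 1)(c_j) for successive j. *)
Definition zero_columns (R : realType) (n p : nat) (h : nat -> R -> R)
    (c : 'I_p -> R) (k : 'I_p -> nat) : seq 'cV[R]_n :=
  flatten [seq [seq hvec n h m (c j) | m <- iota 0 (k j)] | j <- enum 'I_p].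

(* The list of columns has length n exactly when \sum_j k j = n - 1. *)
Definition zero_det (R : realType) (n p : nat) (h : nat -> R -> R)
    (c : 'I_p -> R) (k : 'I_p -> nat) (x : R) : R :=
  \det (\matrix_(i < n, l < n)
          nth 0 (rcons (zero_columns n h c k) (hvec n h 0 x)) l i 0).

(* Main.v *)
(* Sturm's upper bound, after Liouville. Write [S = \sum_j b_j h_j] and
   [T S = \sum_j (lambda_j - lambda_0) b_j h_j]. Since [h_0] does not vanish on
   (0,1), Rolle's theorem with multiplicities applied first to [S / h_0] and then
   to [W = S' h_0 - S h_0'], which vanishes at both end points and satisfies
   [W' = - h_0 T S], shows that [T S] has at least as many zeros as [S], counted
   with multiplicity. Iterating, the normalized [T^k S] converges in C^1 to the
   last eigenfunction [h_m] that occurs in [S], whose zeros in [[0,1]] are simple;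
   so [S] has at most as many zeros as [h_m].
   That [h_m] has at most [m] zeros in (0,1) is Courant's nodal domain argument:
   given [m + 1] zeros, some nonzero combination [w] of restrictions of [h_m] to
   the pieces they cut out, zero on the last piece, is orthogonal to
   [h_0, ..., h_(m-1)]; comparing the Dirichlet energy of [w] minus its partial
   eigenfunction sums with completeness kills the coefficients of [w] beyond [m],
   so [w] is a multiple of [h_m] that vanishes on an interval.
   For the determinant: a combination orthogonal to the [n - 1] columns vanishes
   to the prescribed orders, and one more zero forces it to be trivial, so such
   combinations form a line; the cofactors of the last column span it. *)

Require Import Defs.
From mathcomp Require Import measurable_realfun ring lra zify.

Set Implicit Arguments.
Unset Strict Implicit.
Unset Printing Implicit Defensive.

Import Order.TTheory GRing.Theory Num.Theory.
Local Open Scope classical_set_scope.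
Local Open Scope ring_scope.

(** * Regularity of eigenfunctions up to the end points *)

(** Precomposing with this retraction turns continuity within [[0, 1]] into continuity on the line,
    so that two-sided derivatives of primitives make sense at 0 and 1. *)
Definition clamp01 (R : realType) (x : R) : R := Num.max 0 (Num.min x 1).

Lemma clamp01_bounds (R : realType) (x : R) : 0 <= clamp01 x <= 1.
Proof. by rewrite /clamp01 le_max lexx /= ge_max ler01 ge_min lexx orbT. Qed.

Lemma clamp01_id (R : realType) (x : R) :
  0 <= x <= 1 -> clamp01 x = x.
Proof. by move=> /andP[x0 x1]; rewrite /clamp01 (min_idPl x1) (max_idPr x0). Qed.

Lemma continuous_clamp01 (R : realType) :
  continuous (@clamp01 R).
Proof.
move=> x.
have h1 : {for x, continuous ((@id R) \min (fun=> 1))}.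
  by apply: continuous_min; [exact: cvg_id|exact: cvg_cst].
by apply: (@continuous_max R R (fun=> 0) _ x _ h1); exact: cvg_cst.
Qed.

Lemma within_continuous_clamp01 (R : realType) (f : R -> R) :
  {within `[0, 1], continuous f} ->
  continuous (fun x : R => f (clamp01 x)).
Proof.
move=> cf x.
have xI : `[0, 1]%classic (clamp01 x).
  by rewrite /= in_itv /= clamp01_bounds.
move/subspace_continuousP : cf => /(_ _ xI) cfx.
apply: (cvg_comp (@clamp01 R) f _ cfx) => A.
move=> /(@continuous_clamp01 R x) xA.
suff : nbhs x ((@clamp01 R) @^-1` A) by [].
move: xA => /= ; apply: (@filterS _ (nbhs x)) => y /=.
by apply; rewrite in_itv /= clamp01_bounds.
Qed.

Section is_derive_eta.
Variables (R : realType) (f g : R -> R) (x df dg : R).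
Hypotheses (fE : is_derive x 1 f df) (gE : is_derive x 1 g dg).

Lemma is_derive_addf : is_derive x 1 (fun y => f y + g y) (df + dg).
Proof. exact: is_deriveD. Qed.

Lemma is_derive_subf : is_derive x 1 (fun y => f y - g y) (df - dg).
Proof. exact: is_deriveB. Qed.

Lemma is_derive_mulf : is_derive x 1 (fun y => f y * g y) (df * g x + f x * dg).
Proof.
apply: is_derive_eq (is_deriveM fE gE) _.
by rewrite /GRing.scale /= addrC (mulrC df).
Qed.

Lemma is_derive_scalef (a : R) : is_derive x 1 (fun y => a * f y) (a * df).
Proof. exact: (@is_deriveZ _ _ _ f a). Qed.

End is_derive_eta.

(** Integration starts at [a], to the left of all points of interest; with [a = -1] the point 0 is
    interior and gets a two-sided derivative. *)
Lemma continuous_primitive (R : realType) (f : R -> R) (a : R) :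
  continuous f ->
  exists F : R -> R, forall x, a < x -> is_derive x 1 F (f x).
Proof.
move=> cf; exists (fun x => \int[@lebesgue_measure R]_(t in `[a, x]) f t) => x ax.
have [|| dF <-] := @continuous_FTC1_closed R f a x (x + 1) _ _ ax (cf x).
- by rewrite ltrDl.
- apply: continuous_compact_integrable; first exact: segment_compact.
  exact: continuous_subspaceT.
by rewrite derive1E; exact: DeriveDef.
Qed.

Lemma is_derive_continuous (R : realType) (f : R -> R) (x d : R) :
  is_derive x 1 f d -> {for x, continuous f}.
Proof. by case=> df _; exact/differentiable_continuous/derivable1_diffP. Qed.

Lemma continuous_within_segment (R : realType) (f : R -> R) (a b : R) :
  (forall x : R, a <= x <= b -> {for x, continuous f}) ->
  {within `[a, b], continuous f}.
Proof.
move=> cf; apply: continuous_in_subspaceT => x.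
by rewrite inE /= in_itv /=; exact: cf.
Qed.

Lemma is_derive_within_segment (R : realType) (f df : R -> R) (a b : R) :
  (forall x : R, a <= x <= b -> is_derive x 1 f (df x)) ->
  {within `[a, b], continuous f}.
Proof.
by move=> dfE; apply: continuous_within_segment => x /dfE/is_derive_continuous.
Qed.

Lemma is_derive0_const (R : realType) (f : R -> R) (a b : R) :
  (forall x : R, a < x < b -> is_derive x 1 f 0) ->
  {within `[a, b], continuous f} ->
  forall x, a <= x <= b -> f x = f a.
Proof.
move=> df cf x /andP[]; rewrite le_eqVlt => /predU1P[->//|ax] xb.
have [||c _] := @MVT_segment _ f (fun=> 0) a x (ltW ax).
- move=> y; rewrite in_itv /= => /andP[ay yx].
  by apply: df; rewrite ay (lt_le_trans yx).
- apply: continuous_subspaceW cf => y /=; rewrite !in_itv /= => /andP[->] /=.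
  by move=> /le_trans; apply.
by rewrite mul0r => /eqP; rewrite subr_eq0 => /eqP.
Qed.

(** An eigenfunction is only known to be continuous at 0 and 1. Integrating the equation twice, with
    clamped right-hand sides, yields a first-order system that holds up to the end points. *)
Lemma dirichlet_eigenfunction_C1_extension (R : realType) (q : R -> R) (mu : R)
    (y : R -> R) :
  (forall x : R, 0 <= x <= 1 -> {for x, continuous q}) ->
  dirichlet_eigenfunction q mu y ->
  exists u v : R -> R, forall x : R, 0 <= x <= 1 ->
    [/\ u x = y x, is_derive x 1 u (v x) &
        is_derive x 1 v ((q x - mu) * u x)].
Proof.
move=> cq [cy dy y0 _ _]; pose cl := @clamp01 R.
have cg : continuous (fun x => (q (cl x) - mu) * y (cl x)).
  move=> x; apply: cvgM; last exact: within_continuous_clamp01.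
  apply: cvgB; last exact: cvg_cst.
  apply: (@within_continuous_clamp01 _ q); exact: continuous_within_segment.
have [V0 dV0] := continuous_primitive (-1) cg.
(* The difference of [derive1 y] and [V0] has zero derivative inside, hence is constant; its value
   is read off at the midpoint. *)
pose c := derive1 y 2^-1 - V0 2^-1.
have I0 (x : R) : 0 <= x <= 1 -> -1 < x :> R by lra.
have dV0I (x : R) : 0 <= x <= 1 -> is_derive x 1 V0 ((q x - mu) * y x).
  by move=> xI; have := dV0 x (I0 _ xI); rewrite /cl clamp01_id.
have yE (x : R) : 0 < x < 1 -> derive1 y x = V0 x + c.
  have dd (z : R) : 0 < z < 1 -> is_derive z 1 (fun x => derive1 y x - V0 x) 0.
    move=> zI; have zI' : 0 <= z <= 1 by lra.
    have [|_ ddy yeq] := dy z; first by rewrite in_itv.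
    have dd1 : is_derive z 1 (derive1 y) ((q z - mu) * y z).
      apply: DeriveDef => //; rewrite -derive1E.
      by move: yeq; rewrite derive1nS derive1n1; lra.
    rewrite -(subrr ((q z - mu) * y z)).
    exact: is_derive_subf dd1 (dV0I _ zI').
  move=> xI; have dsub (a b : R) : 0 < a -> b < 1 -> a <= b ->
      derive1 y b - V0 b = derive1 y a - V0 a.
    move=> a0 b1 ab; apply: (@is_derive0_const _ (fun x => derive1 y x - V0 x) a b).
    - by move=> z zab; apply: dd; lra.
    - by apply: (@is_derive_within_segment _ _ (fun=> 0)) => z zab; apply: dd; lra.
    - by rewrite ab lexx.
  rewrite /c; case: (leP x 2^-1) => x2.
    have := dsub x 2^-1 _ _ x2; lra.
  by have := dsub 2^-1 x _ _ (ltW x2); lra.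
pose v x := V0 x + c.
have dv (x : R) : 0 <= x <= 1 -> is_derive x 1 v ((q x - mu) * y x).
  move=> xI; rewrite -[X in is_derive _ _ _ X]addr0.
  exact: is_derive_addf (dV0I _ xI) (is_derive_cst _ _ _).
have [|U dU] := @continuous_primitive _ (fun x => v (cl x)) (-1).
  by apply: within_continuous_clamp01; apply: is_derive_within_segment dv.
pose u x := U x - U 0.
have du (x : R) : 0 <= x <= 1 -> is_derive x 1 u (v x).
  move=> xI; rewrite -[X in is_derive _ _ _ X]subr0.
  apply: is_derive_subf (is_derive_cst _ _ _).
  by have := dU x (I0 _ xI); rewrite /cl clamp01_id.
have uy (x : R) : 0 <= x <= 1 -> u x = y x.
  move=> xI; apply/eqP; rewrite -subr_eq0; apply/eqP.
  rewrite (@is_derive0_const _ (fun x => u x - y x) 0 1 _ _ _ xI).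
  - by rewrite /u subrr y0 subr0.
  - move=> z zI; rewrite -(subrr (v z)); apply: is_derive_subf.
      by apply: du; lra.
    have [|yd _ _] := dy z; first by rewrite in_itv.
    by apply: DeriveDef => //; rewrite -derive1E yE.
  - apply: within_continuousB cy => //.
    exact: is_derive_within_segment du.
by exists u, v => x xI; split; [exact: uy|exact: du|rewrite uy//; exact: dv].
Qed.

(* Gronwall: [E = u^2 + v^2] satisfies [|E'| <= K E], so [E(x) e^(-Kx)] is
   nonincreasing and [E(x) e^(Kx)] nondecreasing. *)
Lemma linear_ode_unique (R : realType) (p u v : R -> R) (M c : R) :
  (forall x : R, 0 <= x <= 1 -> `|p x| <= M) ->
  (forall x : R, 0 <= x <= 1 ->
     is_derive x 1 u (v x) /\ is_derive x 1 v (p x * u x)) ->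
  0 <= c <= 1 -> u c = 0 -> v c = 0 ->
  forall x : R, 0 <= x <= 1 -> u x = 0 /\ v x = 0.
Proof.
move=> pM duv cI uc vc x xI; pose E (y : R) := u y * u y + v y * v y.
pose K : R := 1 + M.
have dE (y : R) : 0 <= y <= 1 -> is_derive y 1 E (2 * (1 + p y) * (u y * v y)).
  move=> /duv[du dv]; rewrite /E.
  apply: is_derive_eq (is_derive_addf (is_derive_mulf du du) (is_derive_mulf dv dv)) _.
  ring.
have dEb (y : R) : 0 <= y <= 1 -> `|2 * (1 + p y) * (u y * v y)| <= K * E y.
  move=> yI; have pyM := pM _ yI; rewrite normrM normrM ger0_norm//.
  have h1 : `|1 + p y| <= K.
    by rewrite (le_trans (ler_normD _ _))// normr1 lerD2l.
  have h2 : 2 * `|u y * v y| <= E y.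
    rewrite normrM /E -!expr2 -(real_normK (num_real (u y))) -(real_normK (num_real (v y))).
    by have := sqr_ge0 (`|u y| - `|v y|); nra.
  rewrite mulrAC mulrC; apply: ler_pM => //.
(* The sign [s] treats both Gronwall monotonicities at once: [s = -1] propagates the zero to the
   right of [c], [s = 1] to the left. *)
have mono (s : R) : `|s| = 1 -> forall a b : R, 0 <= a -> b <= 1 -> a <= b ->
    s * E a * expR (s * K * a) <= s * E b * expR (s * K * b).
  move=> s1 a b a0 b1 ab.
  pose G (y : R) := s * E y * expR (s * K * y).
  pose dG (y : R) := (s * (2 * (1 + p y) * (u y * v y)) + s * s * K * E y)
                     * expR (s * K * y).
  have dGP (y : R) : 0 <= y <= 1 -> is_derive y 1 G (dG y).
    move=> /dE dEy; rewrite /G /dG.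
    have d1 : is_derive y 1 (fun y => s * K * y) (s * K).
      by rewrite -[X in is_derive _ _ _ X]mulr1; exact: is_derive_scalef.
    have d2 := @is_derive1_comp _ expR (fun y => s * K * y) y _ _ (is_derive_expR _) d1.
    apply: is_derive_eq (is_derive_mulf (is_derive_scalef dEy s) d2) _.
    rewrite /=; ring.
  have [||z] := @MVT_segment _ G dG a b ab.
  - by move=> y; rewrite in_itv /= => yab; apply: dGP; lra.
  - by apply: is_derive_within_segment => y yab; apply: dGP; lra.
  rewrite in_itv /= => zab GE; rewrite -subr_ge0 -/(G a) -/(G b) GE.
  have zI : 0 <= z <= 1 by lra.
  have ss : s * s = 1 by rewrite -expr2 -(real_normK (num_real s)) s1 expr1n.
  rewrite mulr_ge0 ?subr_ge0// mulr_ge0 ?expR_ge0//.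
  rewrite ss mul1r addrC -lerBlDr sub0r.
  have : `|s * (2 * (1 + p z) * (u z * v z))| <= K * E z.
    by rewrite normrM s1 mul1r; exact: dEb.
  by rewrite ler_norml lerNl => /andP[].
have Ec : E c = 0 by rewrite /E uc vc mul0r addr0.
have E0 : E x <= 0.
  have [cx|xc] := leP c x.
    have := mono (-1) (normrN1 _) c x; rewrite Ec mulr0 mul0r.
    have := expR_gt0 (-1 * K * x); nra.
  have := mono 1 (normr1 _) x c; rewrite Ec mulr0 mul0r.
  have := expR_gt0 (1 * K * x); nra.
have := sqr_ge0 (u x); have := sqr_ge0 (v x) => v2 u2.
rewrite /E -!expr2 in E0.
by split; apply/eqP; rewrite -sqrf_eq0 eq_le ?u2 ?v2 andbT; lra.
Qed.

Lemma segment_bounded (R : realType) (f : R -> R) :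
  (forall x : R, 0 <= x <= 1 -> {for x, continuous f}) ->
  exists2 M, 0 <= M & forall x : R, 0 <= x <= 1 -> `|f x| <= M.
Proof.
move=> cf.
have [|c _ cM] := @EVT_max _ (fun x => `|f x|) 0 1 ler01.
  apply: continuous_within_segment => x xI.
  by apply: continuous_comp; [exact: cf|exact: norm_continuous].
by exists `|f c| => // x xI; apply: cM; rewrite in_itv.
Qed.

(** * Orders of vanishing *)

(** Iterated derivatives are total functions, so the rules of calculus need differentiability on
    record. The recursion peels off the innermost derivative, in step with [derive1Sn]. *)
Fixpoint ndiff01 (R : realType) (m : nat) (f : R -> R) : Prop :=
  if m is m'.+1 then
    (forall x : R, 0 < x < 1 -> derivable f x 1) /\ ndiff01 m' (derive1 f)
  else True.

(** Only a lower bound on the order: the derivative of order [k] may vanish too. *)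
Definition vanishes (R : realType) (k : nat) (f : R -> R) (c : R) : Prop :=
  forall i, (i < k)%N -> derive1n i f c = 0.

Section smooth.
Variable R : realType.
Implicit Types (f g : R -> R) (x y c : R).

Lemma near_eq_oo f g x : (forall y, 0 < y < 1 -> f y = g y) ->
  0 < x < 1 -> {near x, f =1 g}.
Proof.
move=> fg /andP[x0 x1]; near=> y; apply: fg.
by apply/andP; split; near: y; [exact: lt_nbhsr|exact: lt_nbhsl].
Unshelve. all: by end_near. Qed.

Lemma derive1_eq_oo f g x : (forall y, 0 < y < 1 -> f y = g y) ->
  0 < x < 1 -> derive1 f x = derive1 g x.
Proof.
by move=> fg xI; rewrite !derive1E; apply: near_eq_derive => //;
  exact: near_eq_oo fg xI.
Qed.

Lemma derivable_eq_oo f g x : (forall y, 0 < y < 1 -> f y = g y) ->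
  0 < x < 1 -> derivable f x 1 -> derivable g x 1.
Proof.
by move=> fg xI; apply: near_eq_derivable => //; exact: near_eq_oo fg xI.
Qed.

Lemma derive1n_eq_oo m f g x : (forall y, 0 < y < 1 -> f y = g y) ->
  0 < x < 1 -> derive1n m f x = derive1n m g x.
Proof.
move=> fg; elim: m x => [|m IH] x xI; first exact: fg.
by rewrite !derive1nS; apply: derive1_eq_oo.
Qed.

Lemma is_derive1_val f x d : is_derive x 1 f d -> derive1 f x = d.
Proof. by move=> fd; rewrite derive1E; exact: derive_val. Qed.

Lemma is_derive1_ex f x d : is_derive x 1 f d -> derivable f x 1.
Proof. by case. Qed.

Lemma derivable_is_derive1 f x : derivable f x 1 -> is_derive x 1 f (derive1 f x).
Proof. by move=> df; rewrite derive1E; exact/derivableP. Qed.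

Lemma ndiff01_eq m f g : (forall y, 0 < y < 1 -> f y = g y) ->
  ndiff01 m f -> ndiff01 m g.
Proof.
elim: m f g => //= m IH f g fg [df Cf]; split.
  by move=> x xI; apply: derivable_eq_oo (df x xI).
by apply: IH Cf => y; exact: derive1_eq_oo.
Qed.

Lemma ndiff01W m f : ndiff01 m.+1 f -> ndiff01 m f.
Proof.
elim: m f => //= m IH f [df [df' Cf]]; split=> //.
by apply: IH; split.
Qed.

Lemma ndiff01_derivable m f x : ndiff01 m.+1 f -> 0 < x < 1 ->
  is_derive x 1 f (derive1 f x).
Proof. by move=> [df _] xI; apply: derivable_is_derive1; exact: df. Qed.

Lemma ndiff01_add m f g : ndiff01 m f -> ndiff01 m g -> ndiff01 m (fun x => f x + g x).
Proof.
elim: m f g => //= m IH f g [df Cf] [dg Cg]; split.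
  by move=> x xI; apply: derivableD; [exact: df|exact: dg].
apply: ndiff01_eq (IH _ _ Cf Cg) => y yI; apply/esym/is_derive1_val.
by apply: is_derive_addf; apply: derivable_is_derive1; [exact: df|exact: dg].
Qed.

Lemma ndiff01_cst m (a : R) : ndiff01 m (fun=> a).
Proof.
elim: m a => //= m IH a; split=> [x _|]; first exact: derivable_cst.
by apply: ndiff01_eq (IH 0) => y _; rewrite derive1_cst.
Qed.

Lemma ndiff01_mul m f g : ndiff01 m f -> ndiff01 m g -> ndiff01 m (fun x => f x * g x).
Proof.
elim: m f g => // m IH f g Cf Cg; split.
  move=> x xI; apply: derivableM; [exact: Cf.1|exact: Cg.1].
apply: (@ndiff01_eq _ (fun x => derive1 f x * g x + f x * derive1 g x)).
  move=> y yI; apply/esym/is_derive1_val.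
  by apply: is_derive_mulf; [exact: ndiff01_derivable Cf yI|exact: ndiff01_derivable Cg yI].
by apply: ndiff01_add; apply: IH; [exact: Cf.2|exact: ndiff01W|exact: ndiff01W|exact: Cg.2].
Qed.

Lemma ndiff01_scale m f (a : R) : ndiff01 m f -> ndiff01 m (fun x => a * f x).
Proof. by move=> Cf; apply: ndiff01_mul => //; exact: ndiff01_cst. Qed.

Lemma ndiff01_sub m f g : ndiff01 m f -> ndiff01 m g -> ndiff01 m (fun x => f x - g x).
Proof.
move=> Cf Cg; apply: ndiff01_eq (ndiff01_add Cf (ndiff01_scale (-1) Cg)) => y _.
by rewrite mulN1r.
Qed.

Lemma ndiff01_sum m n (b : 'I_n -> R) (h : 'I_n -> R -> R) :
  (forall j, ndiff01 m (h j)) -> ndiff01 m (fun x => \sum_(j < n) b j * h j x).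
Proof.
move=> Ch; elim: n b h Ch => [|n IH] b h Ch.
  by apply: ndiff01_eq (ndiff01_cst m 0) => y _; rewrite big_ord0.
apply: ndiff01_eq (ndiff01_add (ndiff01_scale (b ord0) (Ch ord0))
  (IH (b \o lift ord0) (h \o lift ord0) (fun j => Ch _))) => y _.
by rewrite big_ord_recl.
Qed.

Lemma derive1n_add m f g x : ndiff01 m f -> ndiff01 m g -> 0 < x < 1 ->
  derive1n m (fun x => f x + g x) x = derive1n m f x + derive1n m g x.
Proof.
elim: m f g => // m IH f g Cf Cg xI; rewrite !derive1Sn.
rewrite -(IH _ _ Cf.2 Cg.2 xI); apply: derive1n_eq_oo => // y yI.
apply: is_derive1_val.
by apply: is_derive_addf; [exact: ndiff01_derivable Cf yI|exact: ndiff01_derivable Cg yI].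
Qed.

Lemma derive1n_scale m f (a : R) x : ndiff01 m f -> 0 < x < 1 ->
  derive1n m (fun x => a * f x) x = a * derive1n m f x.
Proof.
elim: m f => // m IH f Cf xI; rewrite !derive1Sn.
rewrite -(IH _ Cf.2 xI); apply: derive1n_eq_oo => // y yI.
by apply: is_derive1_val; apply: is_derive_scalef; exact: ndiff01_derivable Cf yI.
Qed.

Lemma derive1n_sum m n (b : 'I_n -> R) (h : 'I_n -> R -> R) x :
  (forall j, ndiff01 m (h j)) -> 0 < x < 1 ->
  derive1n m (fun x => \sum_(j < n) b j * h j x) x =
  \sum_(j < n) b j * derive1n m (h j) x.
Proof.
move=> Ch xI; elim: n b h Ch => [|n IH] b h Ch.
  rewrite big_ord0 -[RHS](mul0r (derive1n m (fun=> 0 : R) x)).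
  rewrite -derive1n_scale//; last exact: ndiff01_cst.
  by apply: derive1n_eq_oo => // y _; rewrite big_ord0 mul0r.
rewrite big_ord_recl -(IH (b \o lift ord0) (h \o lift ord0) (fun j => Ch _)).
rewrite -derive1n_scale// -derive1n_add//; last 2 first.
- exact: ndiff01_scale.
- by apply: (@ndiff01_sum m n (b \o lift ord0) (h \o lift ord0)) => j; exact: Ch.
by apply: derive1n_eq_oo => // y _; rewrite big_ord_recl.
Qed.

Lemma vanishes_eq k f g c : (forall y, 0 < y < 1 -> f y = g y) ->
  0 < c < 1 -> vanishes k f c -> vanishes k g c.
Proof. by move=> fg cI fk i ik; rewrite -(derive1n_eq_oo i fg cI) fk. Qed.

Lemma vanishesS k f c :
  vanishes k.+1 f c <-> f c = 0 /\ vanishes k (derive1 f) c.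
Proof.
split=> [fk|[f0 fk] [|i] //]; last by rewrite ltnS derive1Sn; exact: fk.
by split; [exact: fk 0%N _|move=> i ik; rewrite -derive1Sn; exact: fk].
Qed.

Lemma vanishesW k l f c : (l <= k)%N -> vanishes k f c -> vanishes l f c.
Proof. by move=> lk fk i il; apply: fk; exact: leq_trans lk. Qed.

Lemma vanishes_sub k f g c : ndiff01 k f -> ndiff01 k g -> 0 < c < 1 ->
  vanishes k f c -> vanishes k g c -> vanishes k (fun x => f x - g x) c.
Proof.
elim: k f g => [//|k IH] f g Cf Cg cI.
move=> /vanishesS[f0 fk] /vanishesS[g0 gk]; apply/vanishesS.
split; first by rewrite f0 g0 subrr.
apply: vanishes_eq (IH _ _ Cf.2 Cg.2 cI fk gk) => // y yI.
by apply/esym/is_derive1_val/is_derive_subf; [exact: ndiff01_derivable Cf yI|exact: ndiff01_derivable Cg yI].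
Qed.

(** In the Leibniz formula every other term contains a derivative of [g] of order below [m]. *)
Lemma derive1n_mul_vanishes m f g c : ndiff01 m f -> ndiff01 m g -> 0 < c < 1 ->
  vanishes m g c ->
  derive1n m (fun x => f x * g x) c = f c * derive1n m g c.
Proof.
elim: m f g => // m IH f g Cf Cg cI gm.
rewrite !derive1Sn.
rewrite (@derive1n_eq_oo _ _ (fun x => derive1 f x * g x + f x * derive1 g x))//;
  last first.
  by move=> y yI; apply: is_derive1_val; apply: is_derive_mulf;
    [exact: ndiff01_derivable Cf yI|exact: ndiff01_derivable Cg yI].
have Cf' := ndiff01W Cf; have Cg' := ndiff01W Cg.
rewrite derive1n_add//; last 2 first.
- exact: ndiff01_mul Cf.2 Cg'.
- exact: ndiff01_mul Cf' Cg.2.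
have /vanishesS[_ g'm] := gm.
rewrite (IH _ _ Cf.2 Cg' cI (vanishesW (leqnSn m) gm)) (IH _ _ Cf' Cg.2 cI g'm).
by rewrite gm// mulr0 add0r.
Qed.

Lemma vanishes_mul k f g c : ndiff01 k f -> ndiff01 k g -> 0 < c < 1 ->
  vanishes k g c -> vanishes k (fun x => f x * g x) c.
Proof.
move=> Cf Cg cI gk.
suff H i : (i <= k)%N -> ndiff01 i f /\ ndiff01 i g.
  move=> i ik; have [Cfi Cgi] := H i (ltnW ik).
  by rewrite derive1n_mul_vanishes ?gk ?mulr0//; exact: vanishesW (ltnW ik) gk.
move=> ik; rewrite -(subnK ik) in Cf Cg.
elim: (k - i)%N Cf Cg => [//|d IH] Cf Cg.
by apply: IH; exact: ndiff01W.
Qed.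

(** By induction the lower derivatives of [g] vanish, so the next derivative of the product is [f c]
    times that of [g], and [f c] can be divided out. *)
Lemma vanishes_mul_cancel k f g c : ndiff01 k f -> ndiff01 k g -> 0 < c < 1 ->
  f c != 0 -> vanishes k (fun x => f x * g x) c -> vanishes k g c.
Proof.
elim: k => // k IH Cf Cg cI f0 fgk i; rewrite ltnS => ik.
have Cf' := ndiff01W Cf; have Cg' := ndiff01W Cg.
have gk := IH Cf' Cg' cI f0 (vanishesW (leqnSn k) fgk).
move: ik; rewrite leq_eqVlt => /predU1P[->|]; last exact: gk.
have := fgk k (ltnSn k); rewrite derive1n_mul_vanishes//.
by move=> /eqP; rewrite mulf_eq0 (negbTE f0) => /eqP.
Qed.

End smooth.

(** * Zeros counted with multiplicity and Rolle's theorem *)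

(* [(c, k)] stands for a zero [c] of multiplicity at least [k]. *)
Definition lt_fst (R : realType) : rel (R * nat) := fun p r => p.1 < r.1.
Arguments lt_fst {R}.

(** Since the listed multiplicities are lower bounds, this means at least [N] zeros in the open
    interval, counted with multiplicity. *)
Definition has_zeros (R : realType) (f : R -> R) (N : nat) : Prop :=
  exists s : seq (R * nat),
    [/\ sorted lt_fst s,
        forall p, p \in s -> [/\ 0 < p.1 < 1, (0 < p.2)%N & vanishes p.2 f p.1] &
        (\sum_(p <- s) p.2 = N)%N].

Section zeros.
Variable R : realType.
Implicit Types (f g h W : R -> R) (x y c : R) (s : seq (R * nat)).

Lemma lt_fst_trans : transitive (@lt_fst R).
Proof. by move=> p r t; exact: lt_trans. Qed.

(** Pairs of multiplicity 0, which arise when a simple zero is differentiated, are unconstrained and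
    filtered out; they contribute nothing to the sum. *)
Lemma has_zerosW f (s : seq (R * nat)) : sorted lt_fst s ->
  (forall p, p \in s -> (0 < p.2)%N -> 0 < p.1 < 1 /\ vanishes p.2 f p.1) ->
  has_zeros f (\sum_(p <- s) p.2)%N.
Proof.
move=> srt sP; exists [seq p <- s | (0 < p.2)%N]; split.
- exact: (sorted_filter lt_fst_trans).
- by move=> p; rewrite mem_filter => /andP[p0 /sP/(_ p0)[]].
rewrite big_filter [RHS](bigID (fun p => 0 < p.2)%N) /=.
rewrite [X in (_ + X)%N]big1 ?addn0// => p.
by rewrite -eqn0Ngt => /eqP.
Qed.

Lemma has_zeros_transfer f g N :
  (forall k c, 0 < c < 1 -> vanishes k f c -> vanishes k g c) ->
  has_zeros f N -> has_zeros g N.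
Proof.
move=> fg [s [srt sP sN]]; exists s; split=> // p /sP[pI p0 fp].
by split=> //; exact: fg.
Qed.

(* Rolle's theorem with multiplicities: a zero of order [k] of one function is
   a zero of order [k - 1] of the next one, which also vanishes between
   consecutive zeros. *)
Lemma interlaced_zeros (Z Z' : R -> nat -> Prop) (c : R) (k : nat) s :
  (forall x l, Z x l -> (0 < l)%N /\ Z' x l.-1) ->
  (forall x y l m, x < y -> Z x l -> Z y m -> exists2 z, x < z < y & Z' z 1%N) ->
  path lt_fst (c, k) s ->
  (forall p, p \in (c, k) :: s -> Z p.1 p.2) ->
  exists s', [/\ path lt_fst (c, k.-1) s',
    forall p, p \in (c, k.-1) :: s' -> Z' p.1 p.2 &
    ((\sum_(p <- (c, k.-1) :: s') p.2).+1 = \sum_(p <- (c, k) :: s) p.2)%N].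
Proof.
move=> ZZ' gap; elim: s c k => [|[x l] s IH] c k /=.
  move=> _ cZ; have [k0 ck] := ZZ' c k (cZ _ (mem_head _ _)).
  exists [::]; split=> //; last by rewrite !big_seq1 /= prednK.
  by move=> p; rewrite inE => /eqP->.
move=> /andP[cx srt] sZ.
have cZ := sZ _ (mem_head _ _).
have [|s' [srt' sZ' sN]] := IH x l srt; first by move=> p ps; apply: sZ; rewrite inE ps orbT.
have xZ : Z x l by apply: (sZ (x, l)); rewrite !inE eqxx orbT.
have [z /andP[cz zx] zZ] := gap c x k l cx cZ xZ.
have [k0 ck] := ZZ' c k cZ.
(* Each zero loses one and each gap gains one; there is one gap fewer than zeros, so the total drops
   by exactly one. *)
exists ((z, 1%N) :: (x, l.-1) :: s'); split.
- by rewrite /= /lt_fst /= cz zx.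
- move=> p; rewrite inE => /predU1P[->//|]; rewrite inE => /predU1P[->//|].
  exact: sZ'.
by rewrite !big_cons /= in sN *; lia.
Qed.

Lemma has_zeros0 f : has_zeros f 0.
Proof. by exists [::]; rewrite big_nil. Qed.

Lemma has_zeros_sub1 f N : has_zeros f N.+1 -> exists c k s,
  [/\ path lt_fst (c, k) s,
      forall p, p \in (c, k) :: s ->
        [/\ 0 < p.1 < 1, (0 < p.2)%N & vanishes p.2 f p.1] &
      (\sum_(p <- (c, k) :: s) p.2 = N.+1)%N].
Proof.
move=> [[|[c k] s] [srt sP sN]]; first by rewrite big_nil in sN.
by exists c, k, s.
Qed.

(** The Wronskian is [h ^+ 2] times the derivative of [f / h]: Rolle for the quotient gives the
    zeros in the gaps, and at a zero of [f] of order [l] both products vanish to order [l - 1]. *)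
Lemma has_zeros_wronskian f h N :
  (forall m, ndiff01 m f) -> (forall m, ndiff01 m h) ->
  (forall x, 0 < x < 1 -> h x != 0) ->
  has_zeros f N.+1 ->
  has_zeros (fun x => derive1 f x * h x - f x * derive1 h x) N.
Proof.
move=> Cf Ch h0 /has_zeros_sub1[c [k [s [srt sP sN]]]].
set W := fun x => _.
pose Z x l := [/\ 0 < x < 1, (0 < l)%N & vanishes l f x].
pose Z' x l := 0 < x < 1 /\ vanishes l W x.
have ZZ' x l : Z x l -> (0 < l)%N /\ Z' x l.-1.
  case: l => [|l]; first by case.
  move=> [xI _ fx]; split=> //; split=> //.
  apply: vanishes_sub => //; try exact: ndiff01_mul.
  - by apply: ndiff01_mul => //; exact: (Cf l.+1).2.
  - by apply: ndiff01_mul => //; exact: (Ch l.+1).2.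
  - have /vanishesS[_ f'x] := fx.
    have : vanishes l (fun y => h y * derive1 f y) x.
      by apply: vanishes_mul => //; exact: (Cf l.+1).2.
    by apply: vanishes_eq => // y _; rewrite mulrC.
  - have : vanishes l (fun y => derive1 h y * f y) x.
      by apply: vanishes_mul => //; [exact: (Ch l.+1).2|exact: vanishesW fx].
    by apply: vanishes_eq => // y _; rewrite mulrC.
have gap x y l m : x < y -> Z x l -> Z y m -> exists2 z, x < z < y & Z' z 1%N.
  move=> xy [xI l0 fx] [yI m0 fy].
  have f0 t l' : (0 < l')%N -> vanishes l' f t -> f t = 0.
    by move=> l'0 ft; exact: (ft 0%N).
  pose df x := derive1 f x; pose dh x := derive1 h x.
  pose r x := f x * (h x)^-1.
  have dr z : x <= z <= y -> is_derive z 1 r (W z / h z ^+ 2).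
    move=> zI; have zI' : 0 < z < 1 by lra.
    have hz := h0 z zI'.
    have dhz := ndiff01_derivable (Ch 1%N) zI'.
    have dfz := ndiff01_derivable (Cf 1%N) zI'.
    have dhi : is_derive z 1 (fun y => (h y)^-1) (- (h z) ^- 2 * derive1 h z).
      exact: is_deriveV.
    apply: is_derive_eq (is_derive_mulf dfz dhi) _.
    by rewrite /W; field.
  have [z | | | z zxy rz] := @Rolle _ r x y xy.
  + by rewrite in_itv /= => zI; apply: is_derive1_ex (dr z _); lra.
  + exact: is_derive_within_segment dr.
  + by rewrite /r (f0 _ _ l0 fx) (f0 _ _ m0 fy) !mul0r.
  rewrite in_itv /= in zxy; exists z => //; split; first by lra.
  move=> [|//] _; have zI : x <= z <= y by lra.
  have := is_derive1_val (dr z zI); rewrite (is_derive1_val rz) => /esym/eqP.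
  rewrite mulf_eq0 invr_eq0 expf_eq0 /= => /orP[/eqP//|/eqP h00].
  by have := h0 z; rewrite h00 eqxx => /(_ _)/negP; case => //; lra.
have [s' [srt' sZ' sN']] := interlaced_zeros ZZ' gap srt sP.
have -> : N = (\sum_(p <- (c, k.-1) :: s') p.2)%N by apply: succn_inj; rewrite sN' sN.
by apply: has_zerosW => // p /sZ'[].
Qed.

(** The end points count as two further simple zeros of [f], so Rolle starts from [N + 2] zeros and
    loses one. *)
Lemma has_zeros_derive1 f (df : R -> R) N :
  (forall x, 0 <= x <= 1 -> is_derive x 1 f (df x)) ->
  f 0 = 0 -> f 1 = 0 -> has_zeros f N -> has_zeros df N.+1.
Proof.
move=> dfE f0 f1 [s [srt sP sN]].
pose Z x l := (0 < l)%N /\ (0 < x < 1 /\ vanishes l f x \/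
                           ((x == 0) || (x == 1)) /\ l = 1%N).
(* At an end point the reduced multiplicity is 0, so membership of the open interval is demanded for
   positive [l] only. *)
pose Z' x l := 0 <= x <= 1 /\ ((0 < l)%N -> 0 < x < 1 /\ vanishes l df x).
have dfoo x : 0 < x < 1 -> derive1 f x = df x.
  by move=> xI; apply/is_derive1_val/dfE; lra.
have Zf x l : Z x l -> 0 <= x <= 1 /\ f x = 0.
  move=> [l0 [[xI fx]|[/orP[]/eqP-> _]]]; rewrite ?lexx ?ler01 //.
  by split; [lra|exact: (fx 0%N)].
have srt2 : path lt_fst (0, 1%N) (rcons s (1, 1%N)).
  rewrite -cats1 cat_path /= andbT; apply/andP; split.
    case: s srt sP {sN} => //= p s srt sP; rewrite srt andbT.
    by have [/andP[]] := sP p (mem_head _ _).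
  case/lastP: s {srt sN} sP => [|s p] sP; first exact: ltr01.
  rewrite last_rcons.
  by have [|/andP[]] := sP p; first by rewrite mem_rcons mem_head.
have sP2 p : p \in (0, 1%N) :: rcons s (1, 1%N) -> Z p.1 p.2.
  rewrite inE mem_rcons inE => /or3P[/eqP->|/eqP->|/sP[? ? ?]].
  - by split=> //; right; rewrite eqxx.
  - by split=> //; right; rewrite eqxx orbT.
  - by split=> //; left.
have ZZ' x l : Z x l -> (0 < l)%N /\ Z' x l.-1.
  case: l => [|l] Zx; first by case: Zx.
  split=> //; split; first by have [] := Zf _ _ Zx.
  case: Zx => _ [[xI fx]|[_ [->]]]//= l0; split=> //.
  by have /vanishesS[_] := fx; apply: vanishes_eq.
have gap x y l m : x < y -> Z x l -> Z y m -> exists2 z, x < z < y & Z' z 1%N.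
  move=> xy Zx Zy.
  have [xI fx] := Zf _ _ Zx; have [yI fy] := Zf _ _ Zy.
  have [z | | | z zxy rz] := @Rolle _ f x y xy.
  + by rewrite in_itv /= => zI; apply: is_derive1_ex (dfE z _); lra.
  + by apply: is_derive_within_segment => z zI; apply: dfE; lra.
  + by rewrite fx fy.
  rewrite in_itv /= in zxy; exists z => //; split; first by lra.
  move=> _; split; first by lra.
  by move=> [|//] _; rewrite /= -dfoo ?(is_derive1_val rz)//; lra.
have [s' [srt' sZ' sN']] := interlaced_zeros ZZ' gap srt2 sP2.
have -> : N.+1 = (\sum_(p <- (0%R, 0) :: s') p.2)%N.
  apply: succn_inj; rewrite sN' -cats1 big_cons big_cat big_seq1 /= sN.
  by rewrite addnC !addn1.
by apply: has_zerosW => // p /sZ'[_].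
Qed.

End zeros.

(** * Liouville's zero-counting step *)

Lemma is_derive_sumf (R : realType) n (b : 'I_n -> R) (h : 'I_n -> R -> R)
    (dh : 'I_n -> R) (x : R) :
  (forall j, is_derive x 1 (h j) (dh j)) ->
  is_derive x 1 (fun y => \sum_(j < n) b j * h j y) (\sum_(j < n) b j * dh j).
Proof.
elim: n b h dh => [|n IH] b h dh dhE.
  rewrite big_ord0; apply: near_eq_is_derive (is_derive_cst 0 x 1).
  by near=> y; rewrite big_ord0.
rewrite big_ord_recl.
apply: near_eq_is_derive (is_derive_addf (is_derive_scalef (dhE ord0) (b ord0))
  (IH (b \o lift ord0) (h \o lift ord0) (dh \o lift ord0) (fun j => dhE _))).
by near=> y; rewrite big_ord_recl.
Unshelve. all: by end_near. Qed.

Section Liouville.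
Variables (R : realType) (q : R -> R) (lam : nat -> R) (u v : nat -> R -> R).
Hypothesis Cq : forall m, ndiff01 m q.
Hypothesis du : forall j (x : R), 0 <= x <= 1 -> is_derive x 1 (u j) (v j x).
Hypothesis dv : forall j (x : R), 0 <= x <= 1 ->
  is_derive x 1 (v j) ((q x - lam j) * u j x).
Hypothesis u_0 : forall j, u j 0 = 0.
Hypothesis u_1 : forall j, u j 1 = 0.

(** Bootstrapping through the first-order system: each side gains one derivative from the other. *)
Lemma ndiff01_eigenfunction j m : ndiff01 m (u j) /\ ndiff01 m (v j).
Proof.
have W (x : R) : 0 < x < 1 -> 0 <= x <= 1 by move=> /andP[/ltW-> /ltW->].
elim: m => //= m [Cu Cv]; split; split.
- by move=> x /W xI; exact: is_derive1_ex (du j xI).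
- by apply: ndiff01_eq Cv => x /W xI; rewrite (is_derive1_val (du j xI)).
- by move=> x /W xI; exact: is_derive1_ex (dv j xI).
- apply: (@ndiff01_eq _ _ (fun x => (q x - lam j) * u j x)).
    by move=> x /W xI; rewrite (is_derive1_val (dv j xI)).
  by apply: ndiff01_mul => //; apply: ndiff01_sub => //; exact: ndiff01_cst.
Qed.

Definition comb n (b : 'I_n -> R) (x : R) : R := \sum_(j < n) b j * u j x.

Lemma ndiff01_comb n (b : 'I_n -> R) m : ndiff01 m (comb b).
Proof. by apply: ndiff01_sum => j; exact: (ndiff01_eigenfunction j m).1. Qed.

Lemma is_derive_comb n (b : 'I_n -> R) (x : R) : 0 <= x <= 1 ->
  is_derive x 1 (comb b) (\sum_(j < n) b j * v j x).
Proof. by move=> xI; apply: is_derive_sumf => j; exact: du. Qed.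

Hypothesis u0_neq0 : forall x : R, 0 < x < 1 -> u 0%N x != 0.

(** A nonzero count drops by one on passing to the Wronskian with [u 0] and is restored on
    differentiating, because the Wronskian vanishes at both end points. The potential cancels in the
    derivative, and the factor [- u 0] has no zero inside. *)
Lemma has_zeros_liouville n (b : 'I_n -> R) N :
  has_zeros (comb b) N ->
  has_zeros (comb (fun j => (lam j - lam 0%N) * b j)) N.
Proof.
case: N => [_|N sN]; first exact: has_zeros0.
have Cu0 m := (ndiff01_eigenfunction 0 m).1.
pose W x := (\sum_(j < n) b j * v j x) * u 0%N x - comb b x * v 0%N x.
have {sN} WN : has_zeros W N.
  have := has_zeros_wronskian (ndiff01_comb b) Cu0 u0_neq0 sN.
  apply: has_zeros_transfer => k c cI; apply: vanishes_eq => // y /andP[y0 y1].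
  have yI : 0 <= y <= 1 by rewrite !ltW.
  by rewrite (is_derive1_val (is_derive_comb b yI)) (is_derive1_val (du 0 yI)).
have dW (x : R) : 0 <= x <= 1 -> is_derive x 1 W
    (- u 0%N x * comb (fun j => (lam j - lam 0%N) * b j) x).
  move=> xI.
  have dS : is_derive x 1 (fun x => \sum_(j < n) b j * v j x)
      (\sum_(j < n) b j * ((q x - lam j) * u j x)).
    by apply: is_derive_sumf => j; exact: dv.
  have dS' := is_derive_comb b xI.
  apply: is_derive_eq (is_derive_subf (is_derive_mulf dS (du 0 xI))
    (is_derive_mulf dS' (dv 0 xI))) _.
  rewrite /comb mulNr.
  have -> : \sum_(j < n) (lam j - lam 0%N) * b j * u j x =
      (q x - lam 0%N) * (\sum_(j < n) b j * u j x) -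
      \sum_(j < n) b j * ((q x - lam j) * u j x).
    by rewrite mulr_sumr -sumrB; apply: eq_bigr => j _; ring.
  by ring.
have S01 x : (forall j, u j x = 0) -> W x = 0.
  move=> ux; rewrite /W /comb [X in _ - X * _]big1 => [|j _]; last by rewrite ux mulr0.
  by rewrite ux mulr0 mul0r subr0.
have W0 : W 0 = 0 by apply: S01.
have W1 : W 1 = 0 by apply: S01.
have := has_zeros_derive1 dW W0 W1 WN.
apply: has_zeros_transfer => k c cI; apply: vanishes_mul_cancel => //.
- apply: ndiff01_eq (ndiff01_scale (-1) (Cu0 k)) => y _; exact: mulN1r.
- exact: ndiff01_comb.
- by rewrite oppr_eq0; exact: u0_neq0.
Qed.

(** The free factor [a] rescales every step; it will be chosen to make the top ratio equal to 1. *)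
Lemma has_zeros_liouville_iter n (b : 'I_n -> R) (a : R) N k :
  has_zeros (comb b) N ->
  has_zeros (comb (fun j => (a * (lam j - lam 0%N)) ^+ k * b j)) N.
Proof.
move=> bN; elim: k => [|k IH].
  by apply: has_zeros_transfer bN => l c cI; apply: vanishes_eq => // y _;
     apply: eq_bigr => j _; rewrite expr0 mul1r.
move/has_zeros_liouville : IH; apply: has_zeros_transfer => l c cI sl.
have := vanishes_mul (ndiff01_cst l a) (@ndiff01_comb n _ l) cI sl.
apply: vanishes_eq => // y _; rewrite mulr_sumr; apply: eq_bigr => j _.
by rewrite exprS; ring.
Qed.

End Liouville.

(** * Stability of simple zeros *)

(** By compactness the sum of the squares of [f] and [f1], which have no common zero, has a positive
    minimum. *)
Lemma gap_at_simple_zeros (R : realType) (f f1 : R -> R) :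
  (forall x : R, 0 <= x <= 1 -> {for x, continuous f}) ->
  (forall x : R, 0 <= x <= 1 -> {for x, continuous f1}) ->
  (forall x : R, 0 <= x <= 1 -> f x = 0 -> f1 x != 0) ->
  exists2 k : R, 0 < k &
    forall x : R, 0 <= x <= 1 -> `|f x| < k -> 2 * k <= `|f1 x|.
Proof.
move=> cf cf1 f0.
have [|c] := @EVT_min _ (fun x => f x * f x + f1 x * f1 x) 0 1 ler01.
  apply: continuous_within_segment => x xI.
  by apply: continuousD; apply: continuousM; (exact: cf || exact: cf1).
rewrite in_itv /= => cI cmin; pose m := f c * f c + f1 c * f1 c.
have m0 : 0 < m.
  rewrite /m -!expr2; have [fc|fc] := eqVneq (f c) 0.
    by rewrite fc expr0n add0r exprn_even_gt0 //= f0.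
  by rewrite ltr_pwDl// ?sqr_ge0// exprn_even_gt0.
(* If [f] and [f1] were below [k] and [2 * k] in absolute value, the sum of squares would be below
   [5 * k ^+ 2 <= 5 * k <= m]. *)
pose k : R := Num.min 1 (m / 5).
have k0 : 0 < k by rewrite lt_min ltr01 divr_gt0.
have km : 5 * k <= m by rewrite mulrC -ler_pdivlMr// ge_min lexx orbT.
have k1 : k <= 1 by rewrite ge_min lexx.
exists k => // x xI fxk; rewrite leNgt; apply/negP => f1xk.
have := cmin x; rewrite in_itv /= -/m => /(_ xI).
rewrite -!expr2 -(real_normK (num_real (f x))) -(real_normK (num_real (f1 x))).
have h1 : `|f x| ^+ 2 < k ^+ 2 by rewrite !expr2; have := normr_ge0 (f x); nra.
have h2 : `|f1 x| ^+ 2 < (2 * k) ^+ 2.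
  by rewrite !expr2; have := normr_ge0 (f1 x); nra.
have h3 : k ^+ 2 <= k by rewrite expr2 ler_piMr// ltW.
by rewrite exprMn in h2; lra.
Qed.

(** At slope at least [K], moving by [r] in either direction suffices to reverse the sign of
    [t * f c]. Where the window leaves the unit interval, the zero of [f] at the end point takes
    over. *)
Lemma zero_near_steep_point (R : realType) (f f1 : R -> R) (c r K t : R) :
  (forall x : R, 0 <= x <= 1 -> is_derive x 1 f (f1 x)) ->
  f 0 = 0 -> f 1 = 0 -> 0 <= c <= 1 -> 0 < r -> t != 0 ->
  (forall x : R, 0 <= x <= 1 -> `|x - c| <= r -> K <= t * f1 x) ->
  `|t * f c| <= K * r ->
  exists z : R, [/\ 0 <= z <= 1, f z = 0 & `|z - c| <= r].
Proof.
move=> df f0 f1' /andP[c0 c1] r0 t0 tP fc.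
have incr (a b : R) : 0 <= a -> b <= 1 -> a <= b -> c - r <= a -> b <= c + r ->
    K * (b - a) <= t * f b - t * f a.
  move=> a0 b1 ab ca bc.
  have [||z] := @MVT_segment _ f f1 a b ab.
  - by move=> z; rewrite in_itv /= => zI; apply: df; clear -zI a0 b1; lra.
  - by apply: is_derive_within_segment => z zI; apply: df; clear -zI a0 b1; lra.
  rewrite in_itv /= -mulrBr => zI ->; rewrite mulrA ler_wpM2r ?subr_ge0//.
  by apply: tP; rewrite ?ler_norml; clear -zI a0 b1 ca bc; lra.
pose a : R := Num.max 0 (c - r); pose b : R := Num.min 1 (c + r).
have fa : t * f a <= 0 /\ [/\ 0 <= a, a <= c & c - r <= a].
  rewrite /a; case: (leP 0 (c - r)) => h.
    have h1 : K * (c - (c - r)) <= t * f c - t * f (c - r).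
      by apply: incr; clear -h c0 c1 r0; lra.
    rewrite opprB addrC subrK in h1.
    move: fc; rewrite ler_norml => /andP[_ fc].
    by split; [clear -h1 fc; lra|clear -h r0; split; lra].
  by rewrite f0 mulr0; split=> //; clear -h c0; split; lra.
have fb : 0 <= t * f b /\ [/\ b <= 1, c <= b & b <= c + r].
  rewrite /b; case: (leP 1 (c + r)) => h.
    by rewrite f1' mulr0; split=> //; clear -h c1; split; lra.
  have h1 : K * (c + r - c) <= t * f (c + r) - t * f c.
    by apply: incr; clear -h c0 c1 r0; lra.
  rewrite addrC addKr in h1.
  move: fc; rewrite ler_norml => /andP[fc _].
  by split; [clear -h1 fc; lra|clear -h r0; split; lra].
case: fa => fa [a0 ac ca]; case: fb => fb [b1 cb bc].
have [|||z] := @IVT _ (fun x => t * f x) a b 0.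
- exact: le_trans ac cb.
- apply: continuous_within_segment => z zI.
  apply: continuousM; first exact: cvg_cst.
  by apply: is_derive_continuous (df z _); clear -zI a0 b1; lra.
- by rewrite ge_min le_max fa fb orbT.
rewrite in_itv /= => zI tfz; exists z; split.
- by clear -zI a0 b1; lra.
- by move/eqP: tfz; rewrite mulf_eq0 (negbTE t0) => /eqP.
- by rewrite ler_norml; clear -zI ca bc; lra.
Qed.

(* Near a zero [c] of the perturbation [g], both derivatives are bounded away
   from zero with the same sign, so [c] is simple, isolated at scale [d], and
   [f] has a zero within [d / 3] of it. *)
Lemma perturbed_zeros (R : realType) (f f1 : R -> R) (L : R) :
  (forall x : R, 0 <= x <= 1 -> is_derive x 1 f (f1 x)) ->
  (forall x : R, 0 <= x <= 1 -> {for x, continuous f1}) ->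
  (forall x y : R, 0 <= x <= 1 -> 0 <= y <= 1 -> `|f1 x - f1 y| <= L * `|x - y|) ->
  f 0 = 0 -> f 1 = 0 ->
  (forall x : R, 0 <= x <= 1 -> f x = 0 -> f1 x != 0) ->
  exists2 e : R, 0 < e & forall g g1 : R -> R,
    (forall x : R, 0 <= x <= 1 -> is_derive x 1 g (g1 x)) ->
    g 0 = 0 -> g 1 = 0 ->
    (forall x : R, 0 <= x <= 1 -> `|f x - g x| < e /\ `|f1 x - g1 x| < e) ->
    forall N, has_zeros g N -> exists s : seq R,
      [/\ uniq s, size s = N & forall x, x \in s -> 0 < x < 1 /\ f x = 0].
Proof.
move=> df cf1 Lf1 f0 f1' fsimple.
have cf (x : R) : 0 <= x <= 1 -> {for x, continuous f}.
  by move=> /df/is_derive_continuous.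
have [k k0 kP] := gap_at_simple_zeros cf cf1 fsimple.
pose L' : R := 1 + `|L|.
have L'0 : 0 < L' by rewrite ltr_pwDl.
(* Over a distance [d] the derivative [f1] moves by at most [L' * d = k / 2]. *)
pose d := k / (2 * L'); have d0 : 0 < d by rewrite divr_gt0// mulr_gt0.
have Ld : L' * d = k / 2 by rewrite /d; field; rewrite gt_eqF.
(* The first bound keeps the slope of [g] at least [k]. The second gives [|f c| < k * d / 4] at a
   zero [c] of [g], within the [(3 / 2 * k) * (d / 3)] allowed by [zero_near_steep_point]. *)
pose e : R := Num.min (k / 2) (k * d / 4).
have e0 : 0 < e by rewrite lt_min !divr_gt0// mulr_gt0.
have ek : e <= k / 2 by rewrite ge_min lexx.
have ekd : e <= k * d / 4 by rewrite ge_min lexx orbT.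
exists e => // g g1 dg g0 g1' fg N [s [srt sP sN]].
(* Here [t] is the sign of [f1 c]: from [2 * k] at [c], the Lipschitz bound costs [k / 2] and the
   perturbation another [k / 2]. *)
have near (c : R) : 0 <= c <= 1 -> g c = 0 -> exists2 t : R, `|t| = 1 &
    forall x : R, 0 <= x <= 1 -> `|x - c| <= d -> 3 / 2 * k <= t * f1 x /\ k <= t * g1 x.
  move=> cI gc; have [fgc _] := fg c cI; rewrite gc subr0 in fgc.
  have f1c : 2 * k <= `|f1 c| by apply: kP => //; lra.
  exists (Num.sg (f1 c)).
    by rewrite normr_sg; case: eqP f1c => // ->; rewrite normr0; lra.
  move=> x xI xc; have [_ fgx] := fg x xI.
  have h1 : `|f1 x - f1 c| <= k / 2.
    apply: le_trans (Lf1 x c xI cI) _; rewrite -Ld.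
    apply: le_trans (_ : L' * `|x - c| <= _); last by rewrite ler_pM2l.
    rewrite ler_wpM2r// /L'; have := ler_norm L; lra.
  move: fgx h1; rewrite ltr_norml ler_norml; move: f1c.
  case: (sgrP (f1 c)); rewrite ?mul1r ?mulN1r => f1s; rewrite ?f1s ?normr0; lra.
have simple (c : R) : 0 <= c <= 1 -> g c = 0 -> g1 c != 0.
  move=> cI gc; have [t _ /(_ c cI)] := near c cI gc.
  rewrite subrr normr0 (ltW d0) => /(_ isT)[_]; case: eqP => // ->.
  by rewrite mulr0; lra.
have isolated (c c' : R) : 0 <= c -> c' <= 1 -> g c = 0 -> g c' = 0 ->
    c' - c <= d -> c < c' -> False.
  move=> c0 c1 gc gc' ccd cc'.
  have [z|||z] := @Rolle _ g c c' cc'.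
  - by rewrite in_itv /= => zI; apply: is_derive1_ex (dg z _); clear -zI c0 c1; lra.
  - by apply: is_derive_within_segment => z zI; apply: dg; clear -zI c0 c1; lra.
  - by rewrite gc gc'.
  rewrite in_itv /= => zI dgz; have zI' : 0 <= z <= 1 by clear -zI c0 c1; lra.
  have zc : `|z - c| <= d by rewrite ler_norml; clear -zI ccd d0; lra.
  have cI : 0 <= c <= 1 by clear -zI zI' c0; lra.
  have [t _ /(_ z zI' zc)[_]] := near c cI gc.
  have <- := is_derive1_val (dg z zI').
  by rewrite (is_derive1_val dgz) mulr0; lra.
(* End points are sent to themselves, so that injectivity will keep the images of interior zeros
   away from 0 and 1. *)
have zeta (c : R) : exists z : R, 0 <= c <= 1 -> g c = 0 ->
    [/\ 0 <= z <= 1, f z = 0, `|z - c| <= d / 3 & c = 0 \/ c = 1 -> z = c].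
  have [|ne01] := pselect (c = 0 \/ c = 1).
    move=> c01; exists c => cI gc; split=> //; first by case: c01 => ->.
    by rewrite subrr normr0 ltW// divr_gt0.
  have [[cI gc]|ncI] := pselect (0 <= c <= 1 /\ g c = 0); last first.
    by exists 0 => cI gc; case: ncI.
  have [t t1 tP] := near c cI gc.
  have fc : `|t * f c| < k * d / 4.
    have [fgc _] := fg c cI; rewrite gc subr0 in fgc.
    by rewrite normrM t1 mul1r; clear -fgc ekd; lra.
  have [||||z [zI fz zc]] := @zero_near_steep_point _ f f1 c (d / 3) (3 / 2 * k) t
    df f0 f1' cI _ _ _ _.
  - by rewrite divr_gt0.
  - by rewrite -normr_gt0 t1.
  - move=> x xI xc; have [|//] := tP x xI.
    by apply: le_trans xc _; clear -d0; lra.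
  - by clear -fc k0 d0; nra.
  by exists z.
have {zeta} [Z ZP] := choice zeta.
(* Two zeros of [g] with the same image are at most [2 * d / 3] apart, which isolation forbids
   unless they coincide. *)
have Zinj (c c' : R) : 0 <= c <= 1 -> 0 <= c' <= 1 -> g c = 0 -> g c' = 0 ->
    Z c = Z c' -> c = c'.
  move=> cI cI' gc gc' Zcc'.
  have [_ _ h _] := ZP c cI gc; have [_ _ h' _] := ZP c' cI' gc'.
  rewrite Zcc' in h; move: h h'; rewrite !ler_norml => h h'.
  move: cI cI' => /andP[c0 c1] /andP[c0' c1'].
  case: (ltgtP c c') => // cc'; exfalso.
    by apply: (isolated c c') => //; clear -h h' d0; lra.
  by apply: (isolated c' c) => //; clear -h h' d0; lra.
have sP1 p : p \in s -> [/\ 0 < p.1 < 1, g p.1 = 0 & p.2 = 1%N].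
  move=> /sP[pI p0 gp]; split=> //; first exact: (gp 0%N).
  apply/eqP; rewrite eqn_leq p0 andbT leqNgt; apply/negP => p1.
  have pI' : 0 <= p.1 <= 1 by case/andP: pI => /ltW-> /ltW->.
  have := simple _ pI' (gp 0%N p0).
  by rewrite -(is_derive1_val (dg _ pI')) -derive1n1 (gp 1%N p1) eqxx.
exists [seq Z p.1 | p <- s]; split.
- rewrite (map_comp Z fst) map_inj_in_uniq.
    have : sorted <%R [seq p.1 | p <- s] by rewrite sorted_map.
    by apply: sorted_uniq; [exact: lt_trans|exact: ltxx].
  move=> _ _ /mapP[p /sP1[pI gp _] ->] /mapP[r /sP1[rI gr _] ->].
  by apply: Zinj => //; rewrite !ltW //; case/andP: pI => //; case/andP: rI.
- rewrite size_map -sN -sum1_size big_seq [RHS]big_seq.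
  by apply: eq_bigr => p /sP1[_ _ ->].
move=> _ /mapP[p /sP1[pI gp _] ->].
have pI' : 0 <= p.1 <= 1 by case/andP: pI => /ltW-> /ltW->.
have [ZI fZ _ _] := ZP _ pI' gp; split=> //.
have I0 : 0 <= (0 : R) <= 1 by lra.
have I1 : 0 <= (1 : R) <= 1 by lra.
have [_ _ _ Z0] := ZP 0 I0 g0; have [_ _ _ Z1] := ZP 1 I1 g1'.
have n0 : Z p.1 != 0.
  apply/eqP => Zp; have := Zinj p.1 0 pI' I0 gp g0.
  by rewrite Zp Z0; [move=> /(_ erefl) p0; rewrite p0 ltxx in pI|left].
have n1 : Z p.1 != 1.
  apply/eqP => Zp; have := Zinj p.1 1 pI' I1 gp g1'.
  by rewrite Zp Z1; [move=> /(_ erefl) p1; rewrite p1 ltxx andbF in pI|right].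
by case/andP: ZI => Z0' Z1'; rewrite !lt_neqAle Z0' Z1' eq_sym n0 n1.
Qed.

(** * Integrals of continuous functions on subintervals of the unit interval *)

(** Continuity is two-sided even at 0 and 1, as holds for the extended eigenfunctions; it is thus a
    pointwise notion, without subspace topologies. *)
Definition continuous01 (R : realType) (f : R -> R) : Prop :=
  forall x : R, 0 <= x <= 1 -> {for x, continuous f}.

Definition int_seg (R : realType) (x y : R) (f : R -> R) : R :=
  \int[@lebesgue_measure R]_(t in `[x, y]) f t.

(** By disjointness, the extension by 0 from the union is the sum of the two extensions by 0. *)
Lemma integrable_setU2 d (T : measurableType d) (R : realType)
    (mu : {measure set T -> \bar R}) (A B : set T) (g : T -> R) :
  measurable A -> measurable B ->
  [disjoint A & B] ->
  mu.-integrable A (EFin \o g) -> mu.-integrable B (EFin \o g) ->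
  mu.-integrable (A `|` B) (EFin \o g).
Proof.
move=> mA mB /disj_setPS AB gA gB; apply/integrable_mkcond; first exact: measurableU.
have {}gA := (integrable_mkcond (EFin \o g) mA).1 gA.
have {}gB := (integrable_mkcond (EFin \o g) mB).1 gB.
apply: eq_integrable (integrableD measurableT gA gB) => // t _.
rewrite /= !patchE in_setU.
case: ifPn => [tA|_]; case: ifPn => [tB|_] //=; rewrite ?adde0 ?add0e//.
by have [] := AB t; split; exact: set_mem.
Qed.

Section int_seg.
Variable R : realType.
Notation mu := (@lebesgue_measure R).
Implicit Types (f g : R -> R) (x y z : R).

Lemma continuous01_cst (a : R) : continuous01 (fun=> a).
Proof. by move=> x _; exact: cvg_cst. Qed.

Lemma continuous01D f g : continuous01 f -> continuous01 g ->
  continuous01 (fun x => f x + g x).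
Proof. by move=> cf cg x xI; apply: continuousD; [exact: cf|exact: cg]. Qed.

Lemma continuous01M f g : continuous01 f -> continuous01 g ->
  continuous01 (fun x => f x * g x).
Proof. by move=> cf cg x xI; apply: continuousM; [exact: cf|exact: cg]. Qed.

Lemma continuous01Z (a : R) f : continuous01 f -> continuous01 (fun x => a * f x).
Proof. by apply: continuous01M; exact: continuous01_cst. Qed.

Lemma continuous01B f g : continuous01 f -> continuous01 g ->
  continuous01 (fun x => f x - g x).
Proof. by move=> cf cg x xI; apply: continuousB; [exact: cf|exact: cg]. Qed.

Lemma continuous01_eq f g : continuous01 f -> f =1 g -> continuous01 g.
Proof. by move=> cf /funext<-. Qed.

Lemma continuous01_sum n (b : 'I_n -> R) (h : 'I_n -> R -> R) :
  (forall j, continuous01 (h j)) ->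
  continuous01 (fun x => \sum_(j < n) b j * h j x).
Proof.
elim: n b h => [|n IH] b h ch.
  by apply: (continuous01_eq (@continuous01_cst 0)) => x; rewrite big_ord0.
apply: (continuous01_eq (continuous01D (@continuous01Z (b ord0) _ (ch ord0))
  (IH (b \o lift ord0) (h \o lift ord0) (fun j => ch _)))) => x.
by rewrite big_ord_recl.
Qed.

Lemma integrable_seg x y f : 0 <= x -> y <= 1 -> continuous01 f ->
  mu.-integrable `[x, y] (EFin \o f).
Proof.
move=> x0 y1 cf; apply: continuous_compact_integrable.
  exact: segment_compact.
by apply: continuous_within_segment => t tI; apply: cf; lra.
Qed.

Lemma int_seg_add x y f g : 0 <= x -> y <= 1 ->
  continuous01 f -> continuous01 g ->
  int_seg x y (fun t => f t + g t) = int_seg x y f + int_seg x y g.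
Proof. by move=> x0 y1 cf cg; apply: RintegralD => //; exact: integrable_seg. Qed.

Lemma int_seg_sub x y f g : 0 <= x -> y <= 1 ->
  continuous01 f -> continuous01 g ->
  int_seg x y (fun t => f t - g t) = int_seg x y f - int_seg x y g.
Proof. by move=> x0 y1 cf cg; apply: RintegralB => //; exact: integrable_seg. Qed.

Lemma int_seg_scale x y f (a : R) : 0 <= x -> y <= 1 -> continuous01 f ->
  int_seg x y (fun t => a * f t) = a * int_seg x y f.
Proof. by move=> x0 y1 cf; apply: RintegralZl => //; exact: integrable_seg. Qed.

Lemma int_seg_sum x y n (b : 'I_n -> R) (h : 'I_n -> R -> R) :
  0 <= x -> y <= 1 -> (forall j, continuous01 (h j)) ->
  int_seg x y (fun t => \sum_(j < n) b j * h j t) =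
  \sum_(j < n) b j * int_seg x y (h j).
Proof.
move=> x0 y1; elim: n b h => [|n IH] b h ch.
  rewrite big_ord0 -[RHS](mul0r (int_seg x y (fun=> 0))) -int_seg_scale//.
    by congr int_seg; apply/funext => t; rewrite big_ord0 mul0r.
  exact: continuous01_cst.
rewrite big_ord_recl -(IH (b \o lift ord0) (h \o lift ord0) (fun j => ch _)).
rewrite -int_seg_scale// -int_seg_add//; last 2 first.
- exact: continuous01Z.
- by apply: (@continuous01_sum n (b \o lift ord0) (h \o lift ord0)) => j; exact: ch.
by congr int_seg; apply/funext => t; rewrite big_ord_recl.
Qed.

Lemma int_seg_ge0 x y f : (forall t, x <= t <= y -> 0 <= f t) -> 0 <= int_seg x y f.
Proof. by move=> f0; apply: Rintegral_ge0 => t /=; rewrite in_itv; exact: f0. Qed.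

Lemma int_seg_split x y z f : 0 <= x -> z <= 1 -> x <= y -> y <= z ->
  continuous01 f -> int_seg x z f = int_seg x y f + int_seg y z f.
Proof.
move=> x0 z1 xy yz cf; have h := integrable_seg x0 z1 cf.
have := @Rintegral_itvB R f (BLeft x) (BRight z) y h.
rewrite !bnd_simp => /(_ xy yz).
rewrite Rintegral_itv_obnd_cbnd.
  by rewrite /int_seg => <-; rewrite addrC subrK.
apply: integrableS h => //.
by move=> t /=; rewrite !in_itv /= => /andP[/ltW yt ->]; rewrite (le_trans xy yt).
Qed.

Lemma int_seg_ftc x y (F f : R -> R) : 0 <= x -> y <= 1 -> x < y ->
  continuous01 f -> (forall t, x <= t <= y -> is_derive t 1 F (f t)) ->
  int_seg x y f = F y - F x.
Proof.
move=> x0 y1 xy cf dF.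
have cF t : x <= t <= y -> {for t, continuous F}.
  by move=> /dF/is_derive_continuous.
rewrite /int_seg /Rintegral (@continuous_FTC2 _ f F)//.
- by apply: continuous_within_segment => t tI; apply: cf; lra.
- split.
  + by move=> t; rewrite in_itv /= => tI; apply: is_derive1_ex (dF t _); lra.
  + by apply: cvg_at_right_filter; apply: cF; rewrite lexx ltW.
  + by apply: cvg_at_left_filter; apply: cF; rewrite lexx ltW.
- by move=> t; rewrite in_itv /= => tI; apply: is_derive1_val; apply: dF; lra.
Qed.

(** Nonnegativity squeezes the primitive based at [x] to 0 on the whole segment, and [f t] is its
    derivative. *)
Lemma int_seg_eq0 x y f : 0 <= x -> y <= 1 -> x < y -> continuous01 f ->
  (forall t, 0 <= f t) -> int_seg x y f = 0 ->
  forall t, x < t < y -> f t = 0.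
Proof.
move=> x0 y1 xy cf f0 fxy t tI; have ft : {for t, continuous f} by apply: cf; lra.
have fi := integrable_seg x0 y1 cf.
have [||dG <-] := @continuous_FTC1_closed R f x t y _ fi _ ft.
- by case/andP: tI.
- by case/andP: tI.
have I0 s : x <= s <= y -> int_seg x s f = 0.
  move=> sI; have := @int_seg_split x s y f x0 y1; rewrite fxy.
  have h1 : 0 <= int_seg x s f by apply: int_seg_ge0.
  have h2 : 0 <= int_seg s y f by apply: int_seg_ge0.
  case/andP: sI => xs sy /(_ xs sy cf); lra.
rewrite -(derive1_cst (0 : R) t) !derive1E; apply: near_eq_derive.
case/andP: tI => xt ty; near=> s; apply: I0.
by apply/andP; split; apply/ltW; near: s; [exact: lt_nbhsr|exact: lt_nbhsl].
Unshelve. all: by end_near. Qed.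

(* Half-open pieces tile [[z 0, z k[] exactly, so no null sets are involved. *)
Lemma int_piecewise (z : nat -> R) (G : nat -> R -> R) g k :
  0 <= z 0%N -> z k <= 1 -> (forall i, (i < k)%N -> z i < z i.+1) ->
  (forall i, (i < k)%N -> continuous01 (G i)) ->
  (forall i t, (i < k)%N -> z i <= t < z i.+1 -> g t = G i t) ->
  mu.-integrable `[z 0%N, z k[ (EFin \o g) /\
  \int[mu]_(t in `[z 0%N, z k[) g t = \sum_(i < k) int_seg (z i) (z i.+1) (G i).
Proof.
move=> z0; elim: k => [|k IH] zk1 zlt cG gG.
  rewrite set_itvco0 big_ord0; split; last exact: Rintegral_set0.
  exact: integrable_set0.
have zk := zlt k (ltnSn k).
have [||||gi gE] := IH.
- lra.
- by move=> i ik; apply: zlt; exact: leqW.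
- by move=> i ik; apply: cG; exact: leqW.
- by move=> i t ik; apply: gG; exact: leqW.
have z0k : z 0%N <= z k.
  elim: k {IH zk1 cG gG zk gi gE} zlt => // k IH zlt.
  apply: le_trans (IH _) (ltW (zlt k _)) => // i ik; apply: zlt; exact: leqW.
have zk0 : 0 <= z k by exact: le_trans z0k.
have Gi : mu.-integrable `[z k, z k.+1[ (EFin \o G k).
  apply: integrableS (integrable_seg zk0 zk1 (cG k (ltnSn k))) => //.
  by move=> t /=; rewrite !in_itv /= => /andP[-> /ltW].
have gGk : {in `[z k, z k.+1[%classic, G k =1 g}.
  by move=> t; rewrite inE /= in_itv /= => tI; rewrite (gG k).
have gki : mu.-integrable `[z k, z k.+1[ (EFin \o g).
  by apply: eq_integrable Gi => // t tI /=; rewrite gGk.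
have U : `[z 0%N, z k.+1[%classic = `[z 0%N, z k[ `|` `[z k, z k.+1[.
  rewrite (@itv_bndbnd_setU _ _ (BLeft (z 0%N)) (BLeft (z k)) (BLeft (z k.+1)))//.
  by rewrite bnd_simp ltW.
have D : [disjoint `[z 0%N, z k[ & `[z k, z k.+1[].
  apply/disj_setPS => t /= []; rewrite !in_itv /= => /andP[_ tk] /andP[kt _].
  by move: (lt_le_trans tk kt); rewrite ltxx.
have giU : mu.-integrable `[z 0%N, z k.+1[ (EFin \o g).
  by rewrite U; exact: integrable_setU2.
split=> //; rewrite big_ord_recr /= -gE U Rintegral_setU//; last by rewrite -U.
congr (_ + _); transitivity (\int[mu]_(t in `[z k, z k.+1[) G k t).
  exact/esym/eq_Rintegral.
by rewrite Rintegral_itv_bndo_bndc.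
Qed.

End int_seg.

(** * The L^2 norm *)

Section L2_unit.
Variable R : realType.
Notation mu := (@lebesgue_measure R).
Implicit Types (f g : R -> R).

(** This and the next lemma bridge the half-open interval tiled by the pieces and the open interval
    of the [L2] definitions. *)
Lemma integrable_co01_oo01 g :
  mu.-integrable `[0, 1[ (EFin \o g) -> mu.-integrable `]0, 1[ (EFin \o g).
Proof.
apply: integrableS => //.
by move=> t /=; rewrite !in_itv /= => /andP[/ltW-> ->].
Qed.

Lemma Rintegral_co01_oo01 g : mu.-integrable `[0, 1[ (EFin \o g) ->
  \int[mu]_(t in `]0, 1[) g t = \int[mu]_(t in `[0, 1[) g t.
Proof. by move=> /integrable_co01_oo01 gi; exact: Rintegral_itv_obnd_cbnd. Qed.

Lemma L2_unit_integrable f :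
  mu.-integrable `[0, 1[ (EFin \o f) ->
  mu.-integrable `[0, 1[ (EFin \o (fun t => f t ^+ 2)) -> L2_unit f.
Proof.
move=> /integrable_co01_oo01 fi /integrable_co01_oo01 f2.
rewrite /L2_unit; set I := `]0, 1[%classic.
have mI : measurable (I : set (measurableTypeR R)) by exact: measurable_itv.
rewrite inE; apply/andP; split; rewrite inE /=.
  apply/(measurable_restrictT f mI); apply/measurable_EFinP.
  exact: measurable_int fi.
rewrite /finite_norm unlock.
have fi2 : (\int[mu]_x (`|(EFin \o f \_ I) x| `^ 2) < +oo)%E.
  rewrite (_ : (\int[mu]_x _)%E = (\int[mu]_(x in I) (f x ^+ 2)%:E)%E); last first.
    rewrite [RHS]integral_mkcond; apply: eq_integral => x _ /=.
    rewrite !patchE; case: ifPn => _ /=; last by rewrite normr0 powR0.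
    by rewrite powR_mulrn// real_normK ?num_real.
  by apply: integrable_lty => //.
by rewrite poweR_lty.
Qed.

Lemma L2_norm_sqr f : 
  mu.-integrable `[0, 1[ (EFin \o (fun t => f t ^+ 2)) ->
  (L2_norm f `^ 2 = (\int[mu]_(t in `[0, 1[) f t ^+ 2)%:E)%E.
Proof.
move=> fi; have fi' := integrable_co01_oo01 fi.
rewrite /L2_norm poweR_Lnorm// -Rintegral_co01_oo01// /Rintegral fineK.
  rewrite [RHS]integral_mkcond; apply: eq_integral => x _ /=.
  rewrite !patchE; case: ifPn => _ /=; last by rewrite normr0 powR0.
  by rewrite powR_mulrn// real_normK ?num_real.
by apply: integrable_fin_num => //; exact: measurable_itv.
Qed.

Lemma L2_norm_cvg0 (f : nat -> R -> R) :
  (forall N, mu.-integrable `[0, 1[ (EFin \o (fun t => f N t ^+ 2))) ->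
  L2_norm (f N) @[N --> \oo] --> 0%E ->
  \int[mu]_(t in `[0, 1[) f N t ^+ 2 @[N --> \oo] --> 0.
Proof.
move=> fi f0.
have sq N : (\int[mu]_(t in `[0, 1[) f N t ^+ 2) = fine (L2_norm (f N)) ^+ 2.
  have := L2_norm_sqr (fi N).
  have : (0 <= L2_norm (f N))%E by exact: Lnorm_ge0.
  case: (L2_norm (f N)) => [r|_|//] /=.
    by rewrite lee_fin => r0 [<-]; rewrite powR_mulrn.
  (* An infinite norm is excluded, since its square equals a finite integral. *)
  by rewrite ifF ?pnatr_eq0.
rewrite (_ : (fun N => _) = (fun N => fine (L2_norm (f N)) ^+ 2)); last exact/funext.
have : fine (L2_norm (f N)) @[N --> \oo] --> fine 0%E by apply: fine_cvg.
move=> /= h; rewrite -[X in _ --> X](expr0n R 2).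
under eq_fun do rewrite expr2.
rewrite expr2; exact: cvgM.
Qed.

End L2_unit.

Lemma row_kernel_neq0 (F : fieldType) m n (A : 'M[F]_(m, n)) : (n < m)%N ->
  exists2 a : 'rV_m, a != 0 & a *m A = 0.
Proof.
move=> nm; have : kermx A != 0.
  rewrite kermx_eq0; apply/negP => /eqP rA.
  by have := rank_leq_col A; rewrite rA leqNgt nm.
by move=> /rowV0Pn[a /sub_kermxP aA a0]; exists a.
Qed.

(** * Courant's nodal domain argument *)

Section Courant.
Variables (R : realType) (q : R -> R) (lam : nat -> R) (u v : nat -> R -> R).
Hypothesis cq : continuous01 q.
Hypothesis du : forall j (x : R), 0 <= x <= 1 -> is_derive x 1 (u j) (v j x).
Hypothesis dv : forall j (x : R), 0 <= x <= 1 ->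
  is_derive x 1 (v j) ((q x - lam j) * u j x).
Hypothesis u_0 : forall j, u j 0 = 0.
Hypothesis u_1 : forall j, u j 1 = 0.
Hypothesis uv_neq0 : forall j (x : R), 0 <= x <= 1 -> u j x = 0 -> v j x != 0.
Hypothesis lam_lt : forall i j, (i < j)%N -> lam i < lam j.
Hypothesis u_basis : L2_orthonormal_basis u.

Let mu := @lebesgue_measure R.

Lemma continuous01_u j : continuous01 (u j).
Proof. by move=> x /(du j)/is_derive_continuous. Qed.

Lemma continuous01_v j : continuous01 (v j).
Proof. by move=> x /(dv j)/is_derive_continuous. Qed.

Lemma L2_dot_int01 (f g h : R -> R) :
  (forall t, f t * g t = h t) -> continuous01 h -> L2_dot f g = int_seg 0 1 h.
Proof.
move=> fgh ch; rewrite /L2_dot.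
under eq_Rintegral do rewrite fgh.
have hi := integrable_seg (lexx 0) (lexx 1) ch.
have hi' : mu.-integrable `[0, 1[ (EFin \o h).
  by apply: integrableS hi => // t /=; rewrite !in_itv /= => /andP[-> /ltW].
by rewrite Rintegral_co01_oo01// Rintegral_itv_bndo_bndc.
Qed.

Lemma int01_orthonormal i j :
  int_seg 0 1 (fun t => u i t * u j t) = (i == j)%:R.
Proof.
case: u_basis => _ <- _; apply/esym/L2_dot_int01 => //.
by apply: continuous01M; exact: continuous01_u.
Qed.

(* Integration by parts: [(v_n u_j - u_n v_j)' = (lam_j - lam_n) u_n u_j]. *)
Lemma int_seg_green n j (x y : R) : 0 <= x -> y <= 1 -> x < y ->
  u n x = 0 -> u n y = 0 ->
  (lam j - lam n) * int_seg x y (fun t => u n t * u j t) =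
  v n y * u j y - v n x * u j x.
Proof.
move=> x0 y1 xy ux uy.
have cu : continuous01 (fun t => u n t * u j t).
  by apply: continuous01M; exact: continuous01_u.
rewrite -int_seg_scale//.
have dF (t : R) : x <= t <= y -> is_derive t 1 (fun t => v n t * u j t - u n t * v j t)
    ((lam j - lam n) * (u n t * u j t)).
  move=> tI; have tI' : 0 <= t <= 1 by lra.
  apply: is_derive_eq (is_derive_subf (is_derive_mulf (dv n tI') (du j tI'))
    (is_derive_mulf (du n tI') (dv j tI'))) _.
  ring.
by rewrite (int_seg_ftc x0 y1 xy (continuous01Z cu) dF) ux uy !mul0r !subr0.
Qed.

(** The situation Courant's argument excludes: [n + 1] interior zeros of [u n], which together with
    the end points cut the unit interval into [n + 2] pieces. *)
Variables (n : nat) (z : nat -> R).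
Hypothesis z_0 : z 0%N = 0.
Hypothesis z_1 : z n.+2 = 1.
Hypothesis z_lt : forall i, (i < n.+2)%N -> z i < z i.+1.
Hypothesis z_zero : forall i, (i <= n.+2)%N -> u n (z i) = 0.

Let z_le i j : (i <= j <= n.+2)%N -> z i <= z j.
Proof.
move=> /andP[]; elim: j => [|j IH]; rewrite leq_eqVlt => /predU1P[->//|ij] // jn.
exact: le_trans (IH ij (ltnW jn)) (ltW (z_lt jn)).
Qed.

Let z_bounds i : (i <= n.+2)%N -> 0 <= z i <= 1.
Proof. by move=> ik; rewrite -{1}z_0 -z_1 !z_le ?ik ?leqnn. Qed.

Let z_seg i : (i < n.+2)%N -> [/\ 0 <= z i, z i.+1 <= 1 & z i < z i.+1].
Proof.
move=> ik; split; last exact: z_lt.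
  by have /andP[] := z_bounds (ltnW ik).
by have /andP[] := z_bounds ik.
Qed.

Let P i j := int_seg (z i) (z i.+1) (fun t => u n t * u j t).

Lemma sum_int_seg f : continuous01 f ->
  \sum_(i < n.+2) int_seg (z i) (z i.+1) f = int_seg 0 1 f.
Proof.
move=> cf; pose A t := int_seg 0 t f.
rewrite (eq_bigr (fun i : 'I_n.+2 => A (z i.+1) - A (z i))); last first.
  move=> i _; have [zi0 zi1 zi] := z_seg (ltn_ord i).
  have := @int_seg_split _ 0 (z i) (z i.+1) f (lexx 0) zi1 zi0 (ltW zi) cf.
  by rewrite /A => ->; rewrite addrC addKr.
rewrite -(big_mkord xpredT (fun i => A (z i.+1) - A (z i))) telescope_sumr//.
by rewrite z_1 z_0 /A {2}/int_seg set_itv1 Rintegral_set1 subr0.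
Qed.

Variable a : nat -> R.
Hypothesis a_last : a n.+1 = 0.

(** The test function [wf] is [a i * u n] on the piece [i], half-open so that each point lies in one
    piece. Its Fourier coefficients are the [w j], with partial sums [s N] and their derivatives
    [s' N]; [f N i] is the remainder on the piece [i], and [Q N] the squared norm of the whole
    remainder. *)
Let w j := \sum_(i < n.+2) a i * P i j.
Let wf (t : R) := \sum_(i < n.+2) a i * (if z i <= t < z i.+1 then u n t else 0).
Let s N (t : R) := \sum_(j < N) w j * u j t.
Let s' N (t : R) := \sum_(j < N) w j * v j t.
Let f N (i : nat) (t : R) := a i * u n t - s N t.
Let Q N := \sum_(i < n.+2) int_seg (z i) (z i.+1) (fun t => f N i t * f N i t).

Let wf_piece i t : (i < n.+2)%N -> z i <= t < z i.+1 -> wf t = a i * u n t.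
Proof.
move=> ik /andP[it ti]; rewrite /wf (bigD1 (Ordinal ik)) //= it ti /= big1 ?addr0//.
move=> k ki; case: ifP => [/andP[kt tk]|_]; last by rewrite mulr0.
case: (ltngtP k i) => ki'; last by move: ki; rewrite -val_eqE /= ki' eqxx.
  have := @z_le k.+1 i; rewrite ki' ltnW// => /(_ isT); lra.
by have := @z_le i.+1 k; rewrite ki' ltnW// => /(_ isT); lra.
Qed.

Let int_pieces (G : nat -> R -> R) g :
  (forall i, continuous01 (G i)) ->
  (forall i t, (i < n.+2)%N -> z i <= t < z i.+1 -> g t = G i t) ->
  mu.-integrable `[0, 1[ (EFin \o g) /\
  \int[mu]_(t in `[0, 1[) g t = \sum_(i < n.+2) int_seg (z i) (z i.+1) (G i).
Proof.
move=> cG gG; have := @int_piecewise _ z G g n.+2; rewrite z_0 z_1.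
by apply => //.
Qed.

Let continuous01_s N : continuous01 (s N).
Proof. by apply: continuous01_sum => j; exact: continuous01_u. Qed.

Let continuous01_s' N : continuous01 (s' N).
Proof. by apply: continuous01_sum => j; exact: continuous01_v. Qed.

Let continuous01_f N i : continuous01 (f N i).
Proof.
apply: continuous01B => //; apply: continuous01Z; exact: continuous01_u.
Qed.

Let L2_unit_wf : L2_unit wf.
Proof.
apply: L2_unit_integrable.
  apply: (@int_pieces (fun i t => a i * u n t) wf _ wf_piece).1 => i.
  by apply: continuous01Z; exact: continuous01_u.
apply: (@int_pieces (fun i t => (a i * u n t) * (a i * u n t)) _ _ _).1 => [i|i t ik it].
  by apply: continuous01M; apply: continuous01Z; exact: continuous01_u.
by rewrite (wf_piece ik it) expr2.
Qed.

Let L2_dot_wf j : L2_dot wf (u j) = w j.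
Proof.
have [||gi gE] := @int_pieces (fun i t => a i * (u n t * u j t)) (fun t => wf t * u j t).
- by move=> i; apply/continuous01Z/continuous01M; exact: continuous01_u.
- by move=> i t ik it; rewrite (wf_piece ik it) mulrA.
rewrite /L2_dot Rintegral_co01_oo01// gE; apply: eq_bigr => i _.
have [zi0 zi1 zi] := z_seg (ltn_ord i).
by rewrite int_seg_scale//; apply: continuous01M; exact: continuous01_u.
Qed.

(** Completeness of the basis, applied to [wf]. *)
Let Q_cvg0 : Q N @[N --> \oo] --> 0.
Proof.
have [_ _ /(_ _ L2_unit_wf) wf0] := u_basis.
have gP N := @int_pieces (fun i t => f N i t * f N i t)
  (fun t => (wf t - \sum_(j < N) L2_dot wf (u j) * u j t) ^+ 2).
have {}gP N : mu.-integrable `[0, 1[ (EFin \o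
      (fun t => (wf t - \sum_(j < N) L2_dot wf (u j) * u j t) ^+ 2)) /\
    \int[mu]_(t in `[0, 1[)
      (wf t - \sum_(j < N) L2_dot wf (u j) * u j t) ^+ 2 = Q N.
  apply: gP => [i|i t ik it]; first by apply: continuous01M.
  rewrite (wf_piece ik it) expr2 /f /s.
  by under eq_bigr do rewrite L2_dot_wf.
rewrite (_ : Q = fun N => \int[mu]_(t in `[0, 1[)
      (wf t - \sum_(j < N) L2_dot wf (u j) * u j t) ^+ 2).
  by apply: L2_norm_cvg0 => // N; exact: (gP N).1.
by apply/funext => N; rewrite (gP N).2.
Qed.

(** Subtracting the Fourier partial sum leaves a remainder orthogonal to the first [N]
    eigenfunctions; this removes the cross terms from the energy estimate. *)
Let sum_int_f_u N j : (j < N)%N ->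
  \sum_(i < n.+2) int_seg (z i) (z i.+1) (fun t => f N i t * u j t) = 0.
Proof.
move=> jN.
have E (i : 'I_n.+2) : int_seg (z i) (z i.+1) (fun t => f N i t * u j t) =
    a i * P i j - int_seg (z i) (z i.+1) (fun t => s N t * u j t).
  have [zi0 zi1 zi] := z_seg (ltn_ord i).
  rewrite -int_seg_scale//; last by apply: continuous01M; exact: continuous01_u.
  rewrite -int_seg_sub//; last 2 first.
  - by apply/continuous01Z/continuous01M; exact: continuous01_u.
  - by apply: continuous01M => //; exact: continuous01_u.
  by congr int_seg; apply/funext => t; rewrite /f mulrBl mulrA.
rewrite (eq_bigr _ (fun i _ => E i)) sumrB sum_int_seg; last first.
  by apply: continuous01M => //; exact: continuous01_u.
rewrite -/(w j) (_ : (fun t => s N t * u j t) =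
    (fun t => \sum_(l < N) w l * (u l t * u j t))); last first.
  by apply/funext => t; rewrite /s mulr_suml; apply: eq_bigr => l _; rewrite mulrA.
rewrite int_seg_sum//; last by move=> l; apply: continuous01M; exact: continuous01_u.
rewrite (bigD1 (Ordinal jN))//= int01_orthonormal eqxx mulr1 big1 ?addr0 ?subrr//.
move=> l lj; rewrite int01_orthonormal.
by move: lj; rewrite -val_eqE /= => /negbTE ->; rewrite mulr0.
Qed.

(* On each piece, [f = a_i u_n - s_N] satisfies
   [(f f')' = f'^2 + (q - lam_n) f^2 - \sum_j (lam_n - lam_j) w_j f u_j]. *)
Let energy_piece (M : R) N i : (forall x : R, 0 <= x <= 1 -> `|q x| <= M) -> (i < n.+2)%N ->
  a i * (\sum_(j < N) (w j * (lam j - lam n)) * P i j) -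
    (s N (z i.+1) * s' N (z i.+1) - s N (z i) * s' N (z i)) <=
  (lam n + M) * int_seg (z i) (z i.+1) (fun t => f N i t * f N i t) +
  \sum_(j < N) ((lam n - lam j) * w j) *
    int_seg (z i) (z i.+1) (fun t => f N i t * u j t).
Proof.
move=> qM ik; have [zi0 zi1 zi] := z_seg ik.
pose f1 t := a i * v n t - s' N t.
pose f2 t := (q t - lam n) * f N i t - \sum_(j < N) ((lam n - lam j) * w j) * u j t.
pose D t := f1 t * f1 t + f N i t * f2 t.
have df (t : R) : 0 <= t <= 1 -> is_derive t 1 (f N i) (f1 t).
  move=> tI; apply: is_derive_subf.
    by apply: is_derive_scalef; exact: du.
  by apply: is_derive_sumf => j; exact: du.
have df1 (t : R) : 0 <= t <= 1 -> is_derive t 1 f1 (f2 t).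
  move=> tI.
  apply: is_derive_eq (is_derive_subf (is_derive_scalef (dv n tI) (a i))
    (is_derive_sumf (fun j : 'I_N => w j) (fun j : 'I_N => dv j tI))) _.
  rewrite /f2 /f /s mulrBr mulr_sumr -addrA -opprD -big_split /=.
  congr (_ - _); first by ring.
  by apply: eq_bigr => j _; ring.
have cf1 : continuous01 f1.
  by apply: continuous01B => //; apply: continuous01Z; exact: continuous01_v.
have csum : continuous01 (fun t => \sum_(j < N) ((lam n - lam j) * w j) * u j t).
  by apply: continuous01_sum => j; exact: continuous01_u.
have cf2 : continuous01 f2.
  apply: continuous01B => //; apply: continuous01M => //.
  by apply: continuous01B => //; exact: continuous01_cst.
have cD : continuous01 D.
  by apply: continuous01D; apply: continuous01M.
have DE : int_seg (z i) (z i.+1) D = f N i (z i.+1) * f1 (z i.+1) - f N i (z i) * f1 (z i).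
  apply: (@int_seg_ftc _ _ _ (fun t => f N i t * f1 t)) => // t tI.
  have tI' : 0 <= t <= 1 by lra.
  exact: is_derive_mulf (df t tI') (df1 t tI').
(* Since [u n] vanishes at the cut points, only two of the four boundary products survive. *)
have fz k : (k <= n.+2)%N -> f N i (z k) * f1 (z k) =
    s N (z k) * s' N (z k) - a i * (v n (z k) * s N (z k)).
  by move=> kn; rewrite /f /f1 z_zero//; ring.
(* Green's identity turns the mixed boundary term into inner products over the piece. *)
have greenE : v n (z i.+1) * s N (z i.+1) - v n (z i) * s N (z i) =
    \sum_(j < N) (w j * (lam j - lam n)) * P i j.
  rewrite /s !mulr_sumr -sumrB; apply: eq_bigr => j _.
  rewrite -mulrA int_seg_green ?z_zero ?(ltnW ik)//; ring.
have cfu (j : 'I_N) : continuous01 (fun t => f N i t * u j t).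
  by apply: continuous01M => //; exact: continuous01_u.
(* The integrand equals [(q + M) * f ^+ 2 + f1 ^+ 2], where [q + M] is nonnegative. *)
have : 0 <= int_seg (z i) (z i.+1) (fun t => (lam n + M) * (f N i t * f N i t) +
    (\sum_(j < N) ((lam n - lam j) * w j) * (f N i t * u j t)) + D t).
  apply: int_seg_ge0 => t tI; have tI' : 0 <= t <= 1 by lra.
  rewrite (_ : _ + _ = (q t + M) * (f N i t * f N i t) + f1 t * f1 t); last first.
    rewrite /D /f2 (eq_bigr (fun j : 'I_N => f N i t * (((lam n - lam j) * w j) * u j t))).
      by rewrite -mulr_sumr; ring.
    by move=> j _; ring.
  rewrite -!expr2 addr_ge0 ?sqr_ge0// mulr_ge0 ?sqr_ge0//.
  by have := qM t tI'; rewrite ler_norml; lra.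
have cff : continuous01 (fun t => f N i t * f N i t) by apply: continuous01M.
rewrite int_seg_add//; last first.
  apply: continuous01D; first exact: continuous01Z.
  by apply: (@continuous01_sum _ N (fun j => (lam n - lam j) * w j)
    (fun (j : 'I_N) t => f N i t * u j t)).
rewrite int_seg_add//; last 2 first.
- exact: continuous01Z.
- by apply: (@continuous01_sum _ N (fun j => (lam n - lam j) * w j)
    (fun (j : 'I_N) t => f N i t * u j t)).
rewrite int_seg_scale// (@int_seg_sum _ _ _ N (fun j => (lam n - lam j) * w j)
    (fun (j : 'I_N) t => f N i t * u j t))//.
rewrite DE !fz ?(ltnW ik)// -greenE; lra.
Qed.

(** Summing over the pieces, the boundary terms in [s N] and [s' N] telescope to 0 by the Dirichlet
    conditions, the inner products add up to the [w j], and the cross terms vanish by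
    orthogonality. *)
Let energy (M : R) N : (forall x : R, 0 <= x <= 1 -> `|q x| <= M) ->
  \sum_(j < N) (lam j - lam n) * w j ^+ 2 <= (lam n + M) * Q N.
Proof.
move=> qM.
have : \sum_(i < n.+2) (a i * (\sum_(j < N) (w j * (lam j - lam n)) * P i j) -
      (s N (z i.+1) * s' N (z i.+1) - s N (z i) * s' N (z i))) <=
    \sum_(i < n.+2) ((lam n + M) * int_seg (z i) (z i.+1) (fun t => f N i t * f N i t) +
      \sum_(j < N) ((lam n - lam j) * w j) *
        int_seg (z i) (z i.+1) (fun t => f N i t * u j t)).
  by apply: ler_sum => i _; exact: energy_piece.
have E1 : \sum_(i < n.+2) (lam n + M) *
    int_seg (z i) (z i.+1) (fun t => f N i t * f N i t) = (lam n + M) * Q N.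
  by rewrite /Q mulr_sumr.
rewrite sumrB [X in _ <= X -> _]big_split /= E1.
rewrite -(big_mkord xpredT (fun i => s N (z i.+1) * s' N (z i.+1) - s N (z i) * s' N (z i))).
rewrite (telescope_sumr (fun i => s N (z i) * s' N (z i)))// z_0 z_1.
have s0 : s N 0 = 0 by rewrite /s big1// => j _; rewrite u_0 mulr0.
have s1 : s N 1 = 0 by rewrite /s big1// => j _; rewrite u_1 mulr0.
rewrite s0 s1 !mul0r !subr0 [X in _ <= _ + X]exchange_big /= [X in _ <= _ + X]big1 ?addr0.
  rewrite (eq_bigr (fun i : 'I_n.+2 => \sum_(j < N) w j * (lam j - lam n) * (a i * P i j))).
    rewrite exchange_big /= (eq_bigr (fun j : 'I_N => (lam j - lam n) * w j ^+ 2))//.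
    by move=> j _; rewrite -mulr_sumr -/(w j); ring.
  by move=> i _; rewrite mulr_sumr; apply: eq_bigr => j _; ring.
by move=> j _; rewrite -mulr_sumr sum_int_f_u ?mulr0.
Qed.

Hypothesis a_orth : forall j, (j < n)%N -> w j = 0.

(** In the energy sum the terms below [n] vanish by [a_orth], the term [n] has factor 0, and the
    others are nonnegative; so each of these is at most a constant times [Q N], which tends to 0. *)
Let w_gt j : (n < j)%N -> w j = 0.
Proof.
move=> nj; have [M _ qM] := segment_bounded cq.
apply/eqP; rewrite -sqrf_eq0 eq_le sqr_ge0 andbT.
have lnj : 0 < lam j - lam n by rewrite subr_gt0 lam_lt.
have h N : (j < N)%N -> (lam j - lam n) * w j ^+ 2 <= (lam n + M) * Q N.
  move=> jN; apply: le_trans (energy N qM).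
  rewrite (bigD1 (Ordinal jN))//= lerDl sumr_ge0// => l _.
  case: (ltngtP l n) => ln.
  - by rewrite a_orth// expr0n mulr0.
  - by rewrite mulr_ge0 ?sqr_ge0// subr_ge0 ltW// lam_lt.
  - by rewrite ln subrr mul0r.
have cv : (lam n + M) * Q N @[N --> \oo] --> 0.
  by rewrite -(mulr0 (lam n + M)); apply: cvgMr.
rewrite -(pmulr_rle0 _ lnj).
rewrite -(cvg_lim (@Rhausdorff R) cv); apply: limr_ge; first exact: cvgP cv.
by exists j.+1 => // N /=; exact: h.
Qed.

(** Only the coefficient [w n] can survive, so the remainder on the piece [i] is
    [(a i - w n) * u n]. Its norm is constant for [N > n], hence 0, and all [a i] equal the last
    one. *)
Lemma coefficients_eq0 i : (i < n.+2)%N -> a i = 0.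
Proof.
have sE N t : (n < N)%N -> s N t = w n * u n t.
  move=> nN; rewrite /s (bigD1 (Ordinal nN))//= big1 ?addr0// => l.
  rewrite -val_eqE /=; case: (ltngtP l n) => // ln _.
    by rewrite a_orth// mul0r.
  by rewrite w_gt// mul0r.
pose U i := int_seg (z i) (z i.+1) (fun t => u n t * u n t).
have cuu : continuous01 (fun t => u n t * u n t).
  by apply: continuous01M; exact: continuous01_u.
(* If [u n] vanished on a piece, so would its derivative at the midpoint, against [uv_neq0]. *)
have U0 k : (k < n.+2)%N -> 0 < U k.
  move=> kn; have [zi0 zi1 zi] := z_seg kn.
  rewrite lt_neqAle int_seg_ge0 ?andbT; last by move=> t _; rewrite -expr2 sqr_ge0.
  rewrite eq_sym; apply/eqP => Uk.
  have un t : z k < t < z k.+1 -> u n t = 0.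
    move=> tI; apply/eqP; rewrite -sqrf_eq0 expr2; apply/eqP.
    by apply: (int_seg_eq0 zi0 zi1 zi cuu) => // x; rewrite -expr2 sqr_ge0.
  pose t := (z k + z k.+1) / 2; have tI : z k < t < z k.+1 by rewrite /t; lra.
  have tI' : 0 <= t <= 1 by lra.
  have := uv_neq0 tI' (un t tI); rewrite -(is_derive1_val (du n tI')).
  rewrite (_ : derive1 (u n) t = 0) ?eqxx//.
  rewrite -(derive1_cst (0 : R) t) !derive1E; apply: near_eq_derive.
  case/andP: tI => xt ty; near=> x; apply: un.
  by apply/andP; split; near: x; [exact: lt_nbhsr|exact: lt_nbhsl].
have QE N : (n < N)%N -> Q N = \sum_(i < n.+2) (a i - w n) ^+ 2 * U i.
  move=> nN; apply: eq_bigr => k _; have [zi0 zi1 zi] := z_seg (ltn_ord k).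
  rewrite -int_seg_scale//; congr int_seg; apply/funext => t.
  by rewrite /f sE//; ring.
have S0 : \sum_(i < n.+2) (a i - w n) ^+ 2 * U i = 0.
  rewrite -[RHS](cvg_lim (@Rhausdorff R) Q_cvg0); apply/esym/cvg_lim => //.
  by apply: cvg_near_cst; exists n.+1.
have aw k : (k < n.+2)%N -> a k = w n.
  move=> kn; have pos (l : 'I_n.+2) : true -> 0 <= (a l - w n) ^+ 2 * U l.
    by move=> _; rewrite mulr_ge0 ?sqr_ge0// ltW// U0.
  have /eqP := @psumr_eq0P _ _ _ _ pos S0 (Ordinal kn) isT.
  by rewrite mulf_eq0 sqrf_eq0 subr_eq0 (gt_eqF (U0 _ kn)) orbF => /eqP.
by move=> ik; rewrite aw// -(aw n.+1)// a_last.
Unshelve. all: by end_near. Qed.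

End Courant.

(** * Sturm's upper bound *)

Section Sturm.
Variables (R : realType) (q : R -> R) (lam : nat -> R) (u v : nat -> R -> R).
Hypothesis cq : continuous01 q.
Hypothesis Cq : forall m, ndiff01 m q.
Hypothesis du : forall j (x : R), 0 <= x <= 1 -> is_derive x 1 (u j) (v j x).
Hypothesis dv : forall j (x : R), 0 <= x <= 1 ->
  is_derive x 1 (v j) ((q x - lam j) * u j x).
Hypothesis u_0 : forall j, u j 0 = 0.
Hypothesis u_1 : forall j, u j 1 = 0.
Hypothesis uv_neq0 : forall j (x : R), 0 <= x <= 1 -> u j x = 0 -> v j x != 0.
Hypothesis lam_lt : forall i j, (i < j)%N -> lam i < lam j.
Hypothesis u_basis : L2_orthonormal_basis u.

Lemma courant n (s : seq R) : uniq s ->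
  (forall x, x \in s -> 0 < x < 1 /\ u n x = 0) -> (size s <= n)%N.
Proof.
move=> us sP; rewrite leqNgt; apply/negP => ns.
pose r := take n.+1 (sort <=%R s).
have rs x : x \in r -> 0 < x < 1 /\ u n x = 0.
  by move=> /mem_take; rewrite mem_sort; exact: sP.
have szr : size r = n.+1 by rewrite size_takel ?size_sort.
have srt : sorted <%R (0 :: rcons r 1).
  rewrite -cats1 /= cat_path /= andbT.
  have : sorted <%R r.
    apply: take_sorted; rewrite sort_lt_sorted//.
  case: r rs {szr} => [|x r] rs //=.
  move=> ->; rewrite andbT; have [/andP[-> _] _] := rs x (mem_head _ _).
  by have [/andP[_ ->] _] := rs (last x r) (mem_last _ _).
pose z i := nth 0 (0 :: rcons r 1) i.
have szz : size (0 :: rcons r 1) = n.+3 by rewrite /= size_rcons szr.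
have z0 : z 0%N = 0 by [].
have z1 : z n.+2 = 1 by rewrite /z /= nth_rcons szr ltnn eqxx.
have zlt i : (i < n.+2)%N -> z i < z i.+1.
  by move=> ik; apply: (sortedP 0 srt); rewrite szz.
have zz i : (i <= n.+2)%N -> u n (z i) = 0.
  case: i => [|i]; first by rewrite /z /= u_0.
  rewrite ltnS leq_eqVlt => /predU1P[->|ik]; first by rewrite z1.
  rewrite /z /= nth_rcons szr ik.
  by have [|] := rs (nth 0 r i); first by rewrite mem_nth ?szr.
(* One unknown for each piece but the last, one equation for each eigenfunction below [n]: there is
   one more unknown than equations. *)
pose A := \matrix_(i < n.+1, j < n)
  int_seg (z i) (z i.+1) (fun t => u n t * u j t).
have [a a0 aA] := row_kernel_neq0 A (ltnSn n).
(* The default 0 is the weight of the last piece, of index [n + 1]. *)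
pose a' i := if insub i is Some k then a 0 k else 0.
have a'E (k : 'I_n.+1) : a' k = a 0 k by rewrite /a' valK.
have a'n : a' n.+1 = 0 by rewrite /a' insubF ?ltnn.
case/eqP: a0; apply/rowP => k; rewrite mxE -a'E.
apply: (coefficients_eq0 cq du dv u_0 u_1 uv_neq0 lam_lt u_basis z0 z1 zlt zz a'n) => //.
  move=> j jn; rewrite big_ord_recr /= a'n mul0r addr0.
  have := congr1 (fun M : 'rV_n => M 0 (Ordinal jn)) aA; rewrite !mxE => aAj.
  by rewrite -[RHS]aAj; apply: eq_bigr => i _; rewrite mxE /= a'E.
exact: ltn_trans (ltn_ord k) (ltnSn _).
Qed.

Lemma u0_neq0 (x : R) : 0 < x < 1 -> u 0%N x != 0.
Proof.
move=> xI; apply/eqP => ux.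
by have := @courant 0 [:: x] isT; rewrite ltn0 => /(_ _)/negP[]// y; rewrite inE => /eqP->.
Qed.

Lemma lipschitz_v j : exists L : R, forall x y : R, 0 <= x <= 1 -> 0 <= y <= 1 ->
  `|v j x - v j y| <= L * `|x - y|.
Proof.
have c : continuous01 (fun t => (q t - lam j) * u j t).
  apply: continuous01M; last exact: (continuous01_u du).
  by apply: continuous01B => //; exact: continuous01_cst.
have [L L0 LP] := segment_bounded c.
exists L; suff H (x y : R) : 0 <= x <= 1 -> 0 <= y <= 1 -> x <= y ->
    `|v j y - v j x| <= L * `|y - x|.
  move=> x y xI yI; case: (leP x y) => xy; last by apply: H => //; exact: ltW.
  by rewrite distrC [X in _ <= _ * X]distrC; exact: H.
move=> xI yI xy.
have [||t] := @MVT_segment _ (v j) (fun t => (q t - lam j) * u j t) x y xy.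
- by move=> t; rewrite in_itv /= => tI; apply: dv; lra.
- by apply: is_derive_within_segment => t tI; apply: dv; lra.
rewrite in_itv /= => tI ->; rewrite normrM ler_wpM2r// LP//; lra.
Qed.

(** A power iteration: the normalized Liouville iterates keep their [N] zeros and converge to [u m],
    whose zeros are stable because they are simple. *)
Lemma comb_top_has_zeros m (b : 'I_m.+1 -> R) N :
  b ord_max != 0 -> has_zeros (comb u b) N -> (N <= m)%N.
Proof.
move=> bm bN.
have [L LP] := lipschitz_v m.
have [e e0 eP] := perturbed_zeros (du m) (@continuous01_v _ _ _ _ _ dv m) LP
  (u_0 m) (u_1 m) (@uv_neq0 m).
(* The case 0 is separate: the ratios below divide by [lam m - lam 0], and a nonzero multiple of
   [u 0] has no zero anyway. *)
case: m b bm bN {L LP} e e0 eP => [|m] b bm bN e e0 eP.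
  case: N bN => // N /has_zeros_sub1[c [k [s [_ sP _]]]].
  have [cI k0 ck] := sP _ (mem_head _ _).
  have := ck 0%N k0; rewrite /comb /= big_ord1 => /eqP.
  by rewrite (_ : ord0 = ord_max) ?mulf_eq0 ?(negbTE bm) ?(negbTE (u0_neq0 cI))//; exact: val_inj.
pose a := (lam m.+1 - lam 0%N)^-1.
have lm0 : 0 < lam m.+1 - lam 0%N by rewrite subr_gt0 lam_lt.
pose r (j : nat) := a * (lam j - lam 0%N).
have rm : r m.+1 = 1 by rewrite /r mulVf// gt_eqF.
have r0 j : 0 <= r j.
  rewrite mulr_ge0 ?invr_ge0 ?(ltW lm0)//.
  by case: j => [|j]; rewrite ?subrr// subr_ge0 ltW// lam_lt.
have r1 j : (j < m.+1)%N -> r j < 1.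
  by move=> jm; rewrite /r mulrC ltr_pdivrMr// mul1r ltrD2r lam_lt.
(* The top coefficient is 1 and the others decay geometrically, because their ratios lie in [[0,
   1[]. *)
pose c k (j : 'I_m.+2) := (b ord_max)^-1 * (r j ^+ k * b j).
have cN k : has_zeros (comb u (c k)) N.
  have h := has_zeros_liouville_iter Cq du dv u_0 u_1 u0_neq0 a k bN.
  apply: has_zeros_transfer h => l x xI hl.
  have Ck := ndiff01_comb Cq du dv (fun j : 'I_m.+2 => (a * (lam j - lam 0%N)) ^+ k * b j) l.
  have := vanishes_mul (ndiff01_cst l (b ord_max)^-1) Ck xI hl.
  apply: vanishes_eq => // y _; rewrite /comb mulr_sumr; apply: eq_bigr => j _.
  by rewrite /c -/(r j) mulrA.
have [B BP] : exists B : R, forall (j : 'I_m.+2) (x : R), 0 <= x <= 1 ->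
    `|u j x| <= B /\ `|v j x| <= B.
  have h (j : 'I_m.+2) : exists B : R, 0 <= B /\ forall x : R, 0 <= x <= 1 -> `|u j x| <= B /\ `|v j x| <= B.
    have [B1 B10 B1P] := segment_bounded (@continuous01_u _ _ _ du j).
    have [B2 B20 B2P] := segment_bounded (@continuous01_v _ _ _ _ _ dv j).
    exists (B1 + B2); split; first exact: addr_ge0.
    by move=> x xI; have := B1P x xI; have := B2P x xI; lra.
  have [B BP] := choice h.
  exists (\sum_j B j) => j x xI; have [_ /(_ x xI)[uB vB]] := BP j.
  have le : B j <= \sum_j B j.
    by rewrite (bigD1 j)//= lerDl sumr_ge0// => i _; have [] := BP i.
  by split; apply: le_trans le.
(* A common bound for the distances to the top eigenfunction and to its derivative. *)
pose E k := \sum_(j < m.+1) `|c k (widen_ord (leqnSn _) j)| * B.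
have Ecvg : E k @[k --> \oo] --> 0.
  have E0 : \sum_(j < m.+1) (0 : R) = 0 by rewrite big1.
  rewrite -E0 /E.
  apply: cvg_big => [|j _]; first exact: add_continuous.
  rewrite -(mul0r B); apply: cvgMl; rewrite -(normr0 R); apply: cvg_norm.
  rewrite /c -(mulr0 (b ord_max)^-1); apply: cvgMr.
  rewrite -(mul0r (b (widen_ord (leqnSn m.+1) j))); apply: cvgMl.
  by apply: cvg_expr; rewrite ger0_norm ?r0 ?r1 //=.
have [k Ek] : exists k, E k < e.
  have [k _ kP] := cvgr_lt _ Ecvg _ e0.
  by exists k; apply: kP => /=.
have cmax : c k ord_max = 1 by rewrite /c /= rm expr1n mul1r mulVf.
have close (w : nat -> R -> R) (x : R) : (forall j : 'I_m.+2, `|w j x| <= B) ->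
    `|w m.+1 x - \sum_(j < m.+2) c k j * w j x| < e.
  move=> wB; rewrite big_ord_recr /= cmax mul1r opprD addrCA subrr addr0 normrN.
  apply: le_lt_trans Ek; apply: le_trans (ler_norm_sum _ _ _) _.
  apply: ler_sum => j _; rewrite normrM ler_wpM2l//.
  exact: (wB (widen_ord (leqnSn _) j)).
have [||||s [us <- sP]] := eP (comb u (c k)) (fun x => \sum_(j < m.+2) c k j * v j x) _ _ _ _ N (cN k).
- by move=> x; exact: is_derive_comb.
- by rewrite /comb big1// => j _; rewrite u_0 mulr0.
- by rewrite /comb big1// => j _; rewrite u_1 mulr0.
- move=> x xI; split; first by apply: close => j; have [] := BP j x xI.
  by apply: close => j; have [] := BP j x xI.
exact: courant sP.
Qed.

(** Vanishing top coefficients are dropped until the previous lemma applies. *)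
Lemma comb_has_zeros n (b : 'I_n -> R) N :
  (exists j, b j != 0) -> has_zeros (comb u b) N -> (N < n)%N.
Proof.
elim: n b => [|n IH] b bne bN; first by case: bne => -[].
have [bn|bn] := eqVneq (b ord_max) 0; last first.
  exact: comb_top_has_zeros bn bN.
apply: ltnW; rewrite ltnS; apply: (IH (fun j => b (widen_ord (leqnSn n) j))).
  case: bne => j bj; have jn : (j < n)%N.
    rewrite ltn_neqAle -ltnS ltn_ord andbT; apply: contraNneq bj => jn.
    by rewrite (_ : j = ord_max) ?bn//; exact: val_inj.
  by exists (Ordinal jn); rewrite (_ : widen_ord _ _ = j)//; exact: val_inj.
apply: has_zeros_transfer bN => l x xI; apply: vanishes_eq => // y _.
by rewrite /comb big_ord_recr /= bn mul0r addr0.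
Qed.

End Sturm.

(** * The determinant formula *)

Lemma has_zeros_uniq (R : realType) (f : R -> R) (s : seq (R * nat)) :
  uniq [seq p.1 | p <- s] ->
  (forall p, p \in s -> (0 < p.2)%N -> 0 < p.1 < 1 /\ vanishes p.2 f p.1) ->
  has_zeros f (\sum_(p <- s) p.2)%N.
Proof.
move=> us sP; pose le_fst : rel (R * nat) := relpre fst <=%R.
rewrite -(perm_big _ (permEl (perm_sort le_fst s))) /=.
apply: has_zerosW => [|p]; last by rewrite mem_sort; exact: sP.
have : sorted <%R [seq p.1 | p <- sort le_fst s].
  by rewrite -[X in sorted _ X]sort_map sort_lt_sorted.
by rewrite sorted_map.
Qed.

Lemma ndiff01_smooth (R : realType) (f : R -> R) :
  (forall m (x : R), 0 < x < 1 -> derivable (derive1n m f) x 1) ->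
  forall m, ndiff01 m f.
Proof.
move=> df m; elim: m f df => //= m IH f df; split; first exact: df 0%N.
by apply: IH => l x xI; rewrite -derive1Sn; exact: df.
Qed.

(** Norms and inner products see only the open interval, so the extended eigenfunctions inherit the
    basis property. *)
Lemma L2_orthonormal_basis_eq (R : realType) (h u : nat -> R -> R) :
  (forall j (x : R), 0 < x < 1 -> u j x = h j x) ->
  L2_orthonormal_basis h -> L2_orthonormal_basis u.
Proof.
move=> uh [hL2 hdot hcvg].
have restr (f g : R -> R) : (forall x : R, 0 < x < 1 -> f x = g x) ->
    f \_ `]0, 1[ = g \_ `]0, 1[.
  move=> fg; apply/funext => x; rewrite !patchE; case: ifPn => //.
  by rewrite inE /= in_itv /=; exact: fg.
have dotE f j : L2_dot f (u j) = L2_dot f (h j).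
  by apply: eq_Rintegral => x; rewrite inE /= in_itv /= => xI; rewrite uh.
split.
- by move=> j; rewrite /L2_unit (restr (u j) (h j) (uh j)); exact: hL2.
- move=> i j; rewrite dotE -hdot.
  by apply: eq_Rintegral => x; rewrite inE /= in_itv /= => xI; rewrite uh.
- move=> f fL2; have := hcvg f fL2.
  suff -> : (fun N => L2_norm (fun x => f x - \sum_(j < N) L2_dot f (h j) * h j x)) =
      (fun N => L2_norm (fun x => f x - \sum_(j < N) L2_dot f (u j) * u j x)) by [].
  apply/funext => N; rewrite /L2_norm; congr Lnorm.
  congr (EFin \o _); apply: restr => x xI; congr (_ - _).
  by apply: eq_bigr => j _; rewrite dotE uh.
Qed.

(** * Transfer to the given eigenbasis *)

Section eigenbasis.
Variables (R : realType) (q : R -> R) (lambda : nat -> R) (h : nat -> R -> R).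
Hypothesis q_smooth : smooth_near_unit_interval q.
Hypothesis h_basis : dirichlet_eigenbasis q lambda h.

Let cq : continuous01 q.
Proof.
have [U [_ subU dq]] := q_smooth => x xI.
apply: (is_derive_continuous (derivable_is_derive1 _)); apply: (dq 0%N).
by apply: subU; rewrite /= in_itv.
Qed.

Let Cq m : ndiff01 m q.
Proof.
have [U [_ subU dq]] := q_smooth; apply: ndiff01_smooth => l x /andP[x0 x1].
by apply: dq; apply: subU; rewrite /= in_itv /= !ltW.
Qed.

Let oo_cc (x : R) : 0 < x < 1 -> 0 <= x <= 1.
Proof. by move=> /andP[/ltW-> /ltW->]. Qed.

Lemma eigenbasis_comb_has_zeros n (b : 'cV[R]_n) N :
  b != 0 -> has_zeros (linear_comb h b) N -> (N < n)%N.
Proof.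
have ex j : exists uv : (R -> R) * (R -> R), forall x : R, 0 <= x <= 1 ->
    [/\ uv.1 x = h j x, is_derive x 1 uv.1 (uv.2 x) &
        is_derive x 1 uv.2 ((q x - lambda j) * uv.1 x)].
  have [u [v uvP]] := dirichlet_eigenfunction_C1_extension cq
    (eigenbasis_eigenfunction h_basis j).
  by exists (u, v).
have [uv uvP] := choice ex.
pose u j := (uv j).1; pose v j := (uv j).2.
have uh j (x : R) : 0 <= x <= 1 -> u j x = h j x by move=> /(uvP j)[].
have du j (x : R) : 0 <= x <= 1 -> is_derive x 1 (u j) (v j x) by move=> /(uvP j)[].
have dv j (x : R) : 0 <= x <= 1 -> is_derive x 1 (v j) ((q x - lambda j) * u j x).
  by move=> /(uvP j)[].
have I0 : 0 <= (0 : R) <= 1 by rewrite lexx ler01.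
have I1 : 0 <= (1 : R) <= 1 by rewrite lexx ler01.
have u_0 j : u j 0 = 0.
  by rewrite uh//; have [] := eigenbasis_eigenfunction h_basis j.
have u_1 j : u j 1 = 0.
  by rewrite uh//; have [] := eigenbasis_eigenfunction h_basis j.
(* A double zero would make the eigenfunction identically zero, by uniqueness for the linear
   system. *)
have uv_neq0 j (x : R) : 0 <= x <= 1 -> u j x = 0 -> v j x != 0.
  move=> xI ux; apply/eqP => vx.
  have [|M _ MP] := @segment_bounded _ (fun x => q x - lambda j).
    by apply: continuous01B => //; exact: continuous01_cst.
  have duv (y : R) : 0 <= y <= 1 -> is_derive y 1 (u j) (v j y) /\
      is_derive y 1 (v j) ((q y - lambda j) * u j y).
    by move=> yI; split; [exact: du|exact: dv].
  have U := linear_ode_unique MP duv xI ux vx.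
  have [_ _ _ _ [y yI]] := eigenbasis_eigenfunction h_basis j.
  rewrite in_itv /= in yI; rewrite -uh ?(U y (oo_cc yI)).1 ?eqxx//; exact: oo_cc.
have u_basis : L2_orthonormal_basis u.
  apply: L2_orthonormal_basis_eq (eigenbasis_orthonormal_basis h_basis).
  by move=> j x /oo_cc; exact: uh.
move=> b0 bN.
apply: (comb_has_zeros cq Cq du dv u_0 u_1 uv_neq0
  (eigenvalue_increasing h_basis) u_basis (b := fun j => b j 0)).
  have /rV0Pn[j bj] : b^T != 0 by rewrite trmx_eq0.
  by exists j; rewrite mxE in bj.
apply: has_zeros_transfer bN => k c cI; apply: vanishes_eq => // y /oo_cc yI.
by apply: eq_bigr => j _; rewrite uh.
Qed.

Lemma ndiff01_eigenbasis j m : ndiff01 m (h j).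
Proof.
have [u [v uvP]] := dirichlet_eigenfunction_C1_extension cq
  (eigenbasis_eigenfunction h_basis j).
have du (i : nat) (x : R) : 0 <= x <= 1 -> is_derive x 1 u (v x) by move=> /uvP[].
have dv (i : nat) (x : R) : 0 <= x <= 1 -> is_derive x 1 v ((q x - lambda j) * u x).
  by move=> /uvP[].
apply: ndiff01_eq (@ndiff01_eigenfunction _ q (fun=> lambda j) (fun=> u) (fun=> v) Cq du dv 0 m).1.
by move=> x /oo_cc/uvP[].
Qed.

Lemma derive1n_linear_comb n (b : 'cV[R]_n) m (x : R) : 0 < x < 1 ->
  derive1n m (linear_comb h b) x = \sum_i b i 0 * hvec n h m x i 0.
Proof.
move=> xI; rewrite (@derive1n_sum _ m n (fun i => b i 0) (fun i => h i))//.
  by apply: eq_bigr => i _; rewrite mxE.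
by move=> j; exact: ndiff01_eigenbasis.
Qed.

(** Sturm's bound as linear algebra: prescribing [n] or more zeros amounts to linear conditions on
    the coefficients with only the trivial solution. *)
Lemma zeros_eigenbasis_comb n (b : 'cV[R]_n) (s : seq (R * nat)) :
  uniq [seq p.1 | p <- s] ->
  (forall p, p \in s -> 0 < p.1 < 1 /\ forall m, (m < p.2)%N ->
     \sum_i b i 0 * hvec n h m p.1 i 0 = 0) ->
  (n <= \sum_(p <- s) p.2)%N -> b = 0.
Proof.
move=> us sP ns; apply/eqP; apply: contraLR ns => b0; rewrite -ltnNge.
apply: (eigenbasis_comb_has_zeros b0); apply: has_zeros_uniq => // p ps p0.
have [pI pv] := sP p ps; split=> // m mp.
by rewrite derive1n_linear_comb ?pv.
Qed.

End eigenbasis.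

Theorem proposition6p11 (R : realType) (q : R -> R) (lambda : nat -> R)
    (h : nat -> R -> R) (q_smooth : smooth_near_unit_interval q)
    (h_basis : dirichlet_eigenbasis q lambda h)
    (n : nat) (n_ge1 : (1 <= n)%N) (b : 'cV[R]_n) (b_neq0 : b != 0) :
  let S := linear_comb h b in
  [/\ finite_set [set x : R | (x \in `]0, 1[) /\ S x = 0],
      forall x : R, x \in `]0, 1[ -> S x = 0 -> exists k, vanishing_order S x k &
      forall (p : nat) (c : 'I_p -> R) (k : 'I_p -> nat),
        (forall i j : 'I_p, (i < j)%N -> c i < c j) ->
        (forall x : R, (x \in `]0, 1[) /\ S x = 0 <-> exists j, x = c j) ->
        (forall j, vanishing_order S (c j) (k j)) ->
        (\sum_(j < p) k j <= n - 1)%N /\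
        ((\sum_(j < p) k j = n - 1)%N ->
           exists2 C : R, C != 0 &
             forall x : R, x \in `]0, 1[ -> S x = C * zero_det n h c k x)].
Proof.
move=> S.
have SE m (x : R) : 0 < x < 1 -> derive1n m S x = \sum_i b i 0 * hvec n h m x i 0.
  exact: (derive1n_linear_comb q_smooth h_basis).
have zeros0 := zeros_eigenbasis_comb q_smooth h_basis.
have bzeros (s : seq (R * nat)) : uniq [seq p.1 | p <- s] ->
    (forall p, p \in s -> 0 < p.1 < 1 /\ vanishes p.2 S p.1) ->
    (\sum_(p <- s) p.2 < n)%N.
  move=> us sP; rewrite ltnNge; apply/negP => ns; case/eqP: b_neq0.
  apply: (zeros0 n b s us _ ns) => p /sP[pI pv]; split=> // m mp.
  by rewrite -SE// pv.
split.
- apply: contrapT => /(infinite_set_fset n)[B BS nB].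
  suff : (\sum_(r <- [seq (x, 1) | x <- finmap.enum_fset B]) r.2 < n)%N.
    by rewrite big_map sum1_size ltnNge nB.
  apply: bzeros.
    rewrite -map_comp (eq_map (g := id))// map_id; exact: finmap.fset_uniq.
  move=> _ /mapP[x /BS[xI Sx] ->] /=; split; first by rewrite in_itv in xI.
  by case.
- move=> x; rewrite in_itv /= => xI Sx.
  (* Otherwise [x] alone would be a zero of multiplicity [n]. *)
  have [k0 k0P] : exists k, derive1n k S x != 0.
    apply: contrapT => /forallNP nS.
    suff : (\sum_(r <- [:: (x, n)]) r.2 < n)%N by rewrite big_seq1 ltnn.
    apply: bzeros => // r.
    rewrite inE => /eqP-> /=; split=> // i _.
    by apply/eqP; apply: contrapT => /negP; exact: nS.
  case: (ex_minnP (ex_intro (fun k => derive1n k S x != 0) k0 k0P)) => k kP kmin.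
  exists k; split=> // i ik; apply/eqP; apply: contraLR ik => /kmin.
  by rewrite -leqNgt.
move=> p c k clt cP kP.
have cI j : 0 < c j < 1.
  by have [_ /(_ (ex_intro _ j erefl))[]] := cP (c j); rewrite in_itv.
have cinj : injective c.
  move=> i j cij; apply/val_inj; case: (ltngtP i j) => // /clt.
    by rewrite cij ltxx.
  by rewrite cij ltxx.
pose s := [seq (c j, k j) | j <- enum 'I_p].
have us : uniq [seq x.1 | x <- s].
  by rewrite -map_comp map_inj_uniq ?enum_uniq.
have sumE : (\sum_(x <- s) x.2 = \sum_(j < p) k j)%N.
  by rewrite big_map big_enum.
split.
  rewrite subn1 -ltnS prednK// -sumE; apply: bzeros => //.
  by move=> _ /mapP[j _ ->] /=; split=> //; exact: (kP j).2.
move=> sumk.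
(* From here on the dimension is [n.+1]: there are [n] prescribed columns, and the variable column
   has index [ord_max]. *)
case: n n_ge1 b b_neq0 @S SE zeros0 bzeros cP kP sumk => // n _ b b_neq0 S SE zeros0 bzeros cP kP.
rewrite subSS subn0 => sumk.
set cols := zero_columns n.+1 h c k.
have szcols : size cols = n.
  rewrite size_flatten /shape -map_comp sumnE big_map -sumk big_enum /=.
  by apply: eq_bigr => j _; rewrite size_map size_iota.
pose A x : 'M[R]_n.+1 := \matrix_(i, l) nth 0 (rcons cols (hvec n.+1 h 0 x)) l i 0.
have AE x i (l : 'I_n.+1) : (l < n)%N -> A x i l = nth 0 cols l i 0.
  by move=> ln; rewrite mxE nth_rcons szcols ln.
have Amax x i : A x i ord_max = h i x.
  by rewrite mxE nth_rcons szcols ltnn eqxx mxE.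
have mem_cols j m : (m < k j)%N ->
    exists2 l : 'I_n.+1, (l < n)%N & forall x i, A x i l = hvec n.+1 h m (c j) i 0.
  move=> mk; have hc : hvec n.+1 h m (c j) \in cols.
    apply/flattenP; exists [seq hvec n.+1 h m (c j) | m <- iota 0 (k j)].
      by apply/mapP; exists j => //; rewrite mem_enum.
    by apply/mapP; exists m => //; rewrite mem_iota.
  have ln : (index (hvec n.+1 h m (c j)) cols < n)%N.
    by have := hc; rewrite -index_mem szcols.
  exists (Ordinal (leqW ln)) => // x i.
  by rewrite AE//= nth_index.
(* If [S] were identically 0, the point 1/2 would be a zero of multiplicity [n + 1]. *)
have [x0 x0I Sx0] : exists2 x0 : R, 0 < x0 < 1 & S x0 != 0.
  apply: contrapT => nS; have half : 0 < (2^-1 : R) < 1 by lra.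
  have S0 (y : R) : 0 < y < 1 -> S y = 0.
    by move=> yI; apply/eqP; apply: contrapT => /negP Sy; apply: nS; exists y.
  suff : (\sum_(r <- [:: (2^-1 : R, n.+1)]) r.2 < n.+1)%N by rewrite big_seq1 ltnn.
  apply: bzeros => // r.
  rewrite inE => /eqP -> /=; split=> // i _.
  rewrite (@derive1n_eq_oo _ i S (fun=> 0))//.
  by elim: i => // i IH; rewrite derive1Sn (_ : derive1 _ = fun=> 0) ?IH//; apply/funext => y; rewrite derive1_cst.
have x0c j : x0 != c j.
  apply: contra_neq Sx0 => x0E; have [_ /(_ (ex_intro _ j x0E))[]] := cP x0.
  by [].
(* The prescribed orders account for [n] zeros; the extra zero at [x0] is one too many for a
   nontrivial combination. *)
have kill (d : 'cV[R]_n.+1) :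
    (forall j m, (m < k j)%N -> \sum_i d i 0 * hvec n.+1 h m (c j) i 0 = 0) ->
    \sum_i d i 0 * h i x0 = 0 -> d = 0.
  move=> dk d0; apply: (zeros0 _ d ((x0, 1%N) :: s)).
  - rewrite /= us andbT; apply/negP => /mapP[_ /mapP[j _ ->] /= x0E].
    by have := x0c j; rewrite x0E eqxx.
  - move=> r; rewrite inE => /predU1P[->/=|/mapP[j _ ->] /=].
      split=> // -[|//] _; rewrite -[RHS]d0.
      by apply: eq_bigr => i _; rewrite mxE.
    by split=> // m; exact: dk.
  - by rewrite big_cons sumE sumk.
(* A vector in the left kernel of [A x0] gives a combination with exactly the zeros required by
   [kill]. *)
have detA0 : \det (A x0) != 0.
  apply/negP => /det0P[d d0 dA]; case/eqP: d0.
  have dAl (l : 'I_n.+1) : \sum_i d^T i 0 * A x0 i l = 0.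
    have := congr1 (fun M : 'rV_n.+1 => M 0 l) dA; rewrite !mxE => dAl.
    by rewrite -[RHS]dAl; apply: eq_bigr => i _; rewrite mxE.
  rewrite -[d]trmxK (kill d^T) ?trmx0//.
    move=> j m mk; have [l _ lE] := mem_cols j m mk.
    by rewrite -[RHS](dAl l); apply: eq_bigr => i _; rewrite lE.
  by rewrite -[RHS](dAl ord_max); apply: eq_bigr => i _; rewrite Amax.
(* Only the last column of [A x] depends on [x], so these cofactors serve for every [x]. *)
pose e : 'cV[R]_n.+1 := \col_i cofactor (A x0) i ord_max.
have eA (l : 'I_n.+1) : \sum_i e i 0 * A x0 i l = \det (A x0) *+ (l == ord_max).
  have := congr1 (fun M : 'M[R]_n.+1 => M ord_max l) (mul_adj_mx (A x0)).
  rewrite !mxE eq_sym => <-.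
  by apply: eq_bigr => i _; rewrite !mxE.
have detE x : \det (A x) = \sum_i e i 0 * h i x.
  rewrite (expand_det_col _ ord_max); apply: eq_bigr => i _.
  rewrite Amax mulrC !mxE /cofactor; congr (_ * \det _ * _).
  apply/matrixP => i' l; rewrite !mxE.
  have ln : (lift ord_max l < n)%N by rewrite lift_max.
  by rewrite !nth_rcons szcols ln.
(* The constant is forced by comparing both sides at [x0]; then [b - t *: e] meets the conditions of
   [kill]. *)
pose t := S x0 / \det (A x0).
have t0 : t != 0 by rewrite mulf_neq0 ?invr_eq0.
exists t => // x; rewrite in_itv /= => xI.
have bte : b = t *: e.
  apply/eqP; rewrite -subr_eq0; apply/eqP; apply: kill.
    move=> j m mk; have [l ln lE] := mem_cols j m mk.
    rewrite (eq_bigr (fun i => b i 0 * hvec n.+1 h m (c j) i 0 - t * (e i 0 * A x0 i l))).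
      rewrite sumrB -mulr_sumr eA -SE// (kP j).2//.
      by rewrite -val_eqE /= (ltn_eqF ln) mulr0n mulr0 subr0.
    by move=> i _; rewrite lE !mxE mulrBl mulrA.
  rewrite (eq_bigr (fun i => b i 0 * h i x0 - t * (e i 0 * h i x0))).
    by rewrite sumrB -mulr_sumr -detE /t divfK// subrr.
  by move=> i _; rewrite !mxE mulrBl mulrA.
rewrite /zero_det -/(A x) detE mulr_sumr.
by apply: eq_bigr => i _; rewrite bte !mxE mulrA.
Qed.
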